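(* There exist absolute constants $0<c\le C<\infty$ (independent of $p,d,\sigma,s$) such that $$c\;\le\;\mathfrak{C}^{\mathsf{MLE}}(\mathsf{B}^d_p,\sigma)\;\le\; C$$ whenever $(\sigma,p,d)$ satisfies one of the following: (i) $p\in[2,\infty]$, with $\sigma>0$ and $d\ge 1$ arbitrary; (ii) $d\ge 1$, $p\in\big(0,\,1+\tfrac{1}{1+\log d}\big]$, with $\sigma>0$ arbitrary; (iii) $d\ge 1$, $p\in\big(1+\tfrac{1}{1+\log d},\,2\big)$, and $\sigma>0$ satisfies $\sigma\le \tfrac{1}{d^{1/p}}$ or $\sigma\ge\tfrac{1}{\sqrt{1+\log d}}$; (iv) $p=0$, with $\sigma>0$ and $d\ge1$ arbitrary, where in the display above $\mathsf{B}^d_p$ is replaced by $\mathsf{B}^d_0(s)$ for any $s\in\{1,\dots,d\}$.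
   Context: For $x\in\mathbf{R}^d$: $\|x\|_p=(\sum_i|x_i|^p)^{1/p}$ for $p\in(0,\infty)$, $\|x\|_\infty=\max_i|x_i|$, and $\|x\|_0$ is the number of nonzero entries of $x$. Put $\mathsf{B}^d_p=\{x\in\mathbf{R}^d:\|x\|_p\le 1\}$ for $p\in(0,\infty]$ and $\mathsf{B}^d_0(s)=\{x\in\mathbf{R}^d:\|x\|_0\le s\}$. Logarithms are natural. For a closed set $\Theta\subset\mathbf{R}^d$, $\Pi_\Theta(y)\in\arg\min_{\vartheta\in\Theta}\|\vartheta-y\|_2^2$ is the Euclidean projection (the maximum likelihood estimator, MLE, in the model $Y\sim\mathsf N(\theta^\star,\sigma^2I_d)$ with $\theta^\star\in\Theta$); for the nonconvex sets ($p\in[0,1)$) it is almost surely unique under a Gaussian $Y$, and ties are broken arbitrarily (measurably). Define $$\mathcal R^{\mathsf{MLE}}(\Theta,\sigma)=\sup_{\theta^\star\in\Theta}\mathbf E_{Y\sim\mathsf N(\theta^\star,\sigma^2I_d)}\|\Pi_\Theta(Y)-\theta^\star\|_2^2,\qquad \mathcal M(\Theta,\sigma)=\inf_{\hat\theta}\sup_{\theta^\star\in\Theta}\mathbf E_{Y\sim\mathsf N(\theta^\star,\sigma^2I_d)}\|\hat\theta(Y)-\theta^\star\|_2^2,$$ the infimum being over all measurable $\hat\theta:\mathbf R^d\to\mathbf R^d$, and the competitive ratio $\mathfrak C^{\mathsf{MLE}}(\Theta,\sigma)=\mathcal R^{\mathsf{MLE}}(\Theta,\sigma)/\mathcal M(\Theta,\sigma)$.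 *)

(* Defs.v *)
From HB Require Import structures.
From mathcomp Require Import all_boot all_order all_algebra.
From mathcomp Require Import all_classical all_reals all_analysis.

Set Implicit Arguments.
Unset Strict Implicit.
Unset Printing Implicit Defensive.
Import Order.TTheory GRing.Theory Num.Theory.
Import numFieldNormedType.Exports.

Local Open Scope classical_set_scope.
Local Open Scope ring_scope.

(* R^d is [d.-tuple R], which carries the product of the Borel sigma-algebras
   on its coordinates. *)

Definition lp_norm (R : realType) (d : nat) (p : \bar R) (x : d.-tuple R) : R :=
  match p with
  | q%:E => (\sum_(i < d) `|tnth x i| `^ q) `^ q^-1
  | +oo%E => \big[Num.max/0]_(i < d) `|tnth x i|
  | -oo%E => 0 (* junk value: only positive p are used *)
  end.

Definition l0_norm (R : realType) (d : nat) (x : d.-tuple R) : nat :=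
  #|[pred i : 'I_d | tnth x i != 0]|.

Definition lp_ball (R : realType) (d : nat) (p : \bar R) : set (d.-tuple R) :=
  [set x | lp_norm p x <= 1].

Definition l0_ball (R : realType) (d s : nat) : set (d.-tuple R) :=
  [set x | (l0_norm x <= s)%N].

Arguments lp_ball {R} d p.
Arguments l0_ball {R} d s.

Definition sqdist (R : realType) (d : nat) (x y : d.-tuple R) : R :=
  \sum_(i < d) (tnth x i - tnth y i) ^+ 2.

Section gaussian.
Context {R : realType}.

(* [normal_prob] lives on [measurableTypeR R]: the same type and sigma-algebra
   as [R], with another display. *)
Definition tcons (n : nat) (u : measurableTypeR R * n.-tuple R) : n.+1.-tuple R :=
  [tuple of u.1 :: u.2].

Lemma measurable_tcons (n : nat) : measurable_fun setT (@tcons n).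
Proof.
exact: (@measurable_cons _ _ (measurableTypeR R * n.-tuple R)%type R
  fst n snd measurable_fst measurable_snd).
Qed.

HB.instance Definition _ (n : nat) :=
  isMeasurableFun.Build _ _ _ _ (@tcons n) (@measurable_tcons n).

(* N(theta, sigma^2 I_n) as the product of the one-dimensional laws
   N(theta_i, sigma^2); [sigma] is the standard deviation. *)
Fixpoint gaussian (n : nat) (sigma : R) :
    n.-tuple R -> probability (n.-tuple R) R :=
  match n with
  | 0 => fun _ => \d_([tuple] : 0.-tuple R)
  | m.+1 => fun theta =>
      distribution (normal_prob (thead theta) sigma
                    \x gaussian sigma [tuple of behead theta])%E
                   (@tcons m)
  end.

Lemma gaussian_rectangle (n : nat) (sigma : R) (theta : n.-tuple R)
    (A : 'I_n -> set R) : (forall i, measurable (A i)) ->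
  gaussian sigma theta [set y | forall i, A i (tnth y i)] =
  (\prod_(i < n) normal_prob (tnth theta i) sigma (A i))%E.
Proof.
elim: n theta A => [|n IH] theta A mA.
  rewrite big_ord0 /= diracE mem_set//=.
  by case.
rewrite big_ord_recl /= /distribution /pushforward.
rewrite (_ : _ @^-1` _ = A ord0 `*`
   [set y : n.-tuple R | forall i, A (lift ord0 i) (tnth y i)]); last first.
  apply/seteqP; split => -[a y] /=.
    move=> H; split; first exact: (H ord0).
    by move=> i; have := H (lift ord0 i); rewrite tnthS.
  case=> H0 H i; case: (unliftP ord0 i) => [j ->|->]; last exact: H0.
  by rewrite tnthS; exact: H.
have mB : measurable
    [set y : n.-tuple R | forall i, A (lift ord0 i) (tnth y i)].
  rewrite (_ : [set y | _] = \big[setI/setT]_(i <- enum 'I_n)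
     ((fun y : n.-tuple R => tnth y i) @^-1` A (lift ord0 i))).
    apply: bigsetI_measurable => i _.
    by rewrite -[X in measurable X]setTI; exact: measurable_tnth.
  rewrite -bigcap_seq; apply/seteqP; split => y /= H i; first by move=> _; exact: H.
  by apply: H; rewrite /= mem_enum.
rewrite product_measure1E; [|exact: mA|exact: mB].
have E := IH [tuple of behead theta] (fun i => A (lift ord0 i))
  (fun i => mA _).
apply: (@f_equal2 _ _ _ (@mule R)); first by [].
apply: (etrans E); apply: eq_bigr => i _.
by rewrite [in RHS](tuple_eta theta) tnthS.
Qed.

End gaussian.

Section minimax.
Context {R : realType} {d : nat}.
Local Open Scope ereal_scope.

Definition risk (sigma : R) (est : d.-tuple R -> d.-tuple R)
    (theta : d.-tuple R) : \bar R :=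
  \int[gaussian sigma theta]_y (sqdist (est y) theta)%:E.

Definition worst_risk (Theta : set (d.-tuple R)) (sigma : R)
    (est : d.-tuple R -> d.-tuple R) : \bar R :=
  ereal_sup [set risk sigma est theta | theta in Theta].

Definition minimax_risk (Theta : set (d.-tuple R)) (sigma : R) : \bar R :=
  ereal_inf [set worst_risk Theta sigma est |
    est in [set est : d.-tuple R -> d.-tuple R | measurable_fun setT est]].

Definition is_mle (Theta : set (d.-tuple R))
    (Pi : d.-tuple R -> d.-tuple R) : Prop :=
  measurable_fun setT Pi /\
  forall y, Theta (Pi y) /\
    forall theta, Theta theta -> (sqdist (Pi y) y <= sqdist theta y)%R.

(* [Pi] is the chosen version of the projection onto [Theta]. *)
Definition competitive_ratio (Theta : set (d.-tuple R)) (sigma : R)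
    (Pi : d.-tuple R -> d.-tuple R) : \bar R :=
  worst_risk Theta sigma Pi / minimax_risk Theta sigma.

End minimax.

(* Main.v *)
(* Lower bound: cut the coordinates into k blocks of length m = floor(d/k) and
   put in each block, independently, nothing with probability 1/2 and otherwise
   a spike of height tau at a uniform place.  Inside a block the likelihood
   ratio of the spike mixture has second moment at most 1 + e^(tau^2/sigma^2)/m,
   so as long as e^(tau^2/sigma^2) <= 1 + m the two hypotheses cannot be told
   apart and the minimax risk is at least k tau^2 / 16.

   Upper bound: D = Pi(Y) - theta satisfies |D|^2 <= 2 <Y - theta, D>, and
   truncating each product at a level tau gives
     |D|^2 <= 4 tau sum_i min(|D_i|, tau)
              + (a noise term of mean O(sigma^2 d e^(-tau^2/(8 sigma^2)))).
   The sum is controlled by the geometry of the set, and taking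
   tau ~ u = sigma sqrt(1 + ln(d/k)) balances both terms at order k u^2.

   For l_p balls with p < 2 the sparsity k is the crossing point of
   k (sigma sqrt(1 + ln(d/k)))^p with 1; if there is none, either a cube of
   side sigma / 2 lies in the ball (k = d) or a single spike of constant size
   is undetectable (k = 1).  For p >= 2 the inscribed cube always suffices. *)

Require Import Defs.
From HB Require Import structures.
From mathcomp Require Import all_boot all_order all_algebra.
From mathcomp Require Import all_classical all_reals all_analysis.
From mathcomp Require Import measurable_realfun.
From mathcomp Require Import zify ring lra.

Set Implicit Arguments.
Unset Strict Implicit.
Unset Printing Implicit Defensive.
Import Order.TTheory GRing.Theory Num.Theory.
Import numFieldNormedType.Exports.

Local Open Scope classical_set_scope.
Local Open Scope ring_scope.

(** * Gaussian integrals *)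

Section normal_integrals.
Context {R : realType}.
Implicit Types (m s t : R) (f : measurableTypeR R -> \bar R).
Local Notation mu := (@lebesgue_measure R).

Lemma integral_normal_prob m s f :
  (forall x, (0 <= f x)%E) -> measurable_fun setT f ->
  (\int[normal_prob m s]_x f x = \int[mu]_x (f x * (normal_pdf m s x)%:E))%E.
Proof.
move=> f0 mf.
have dom : normal_prob m s `<< mu by exact: normal_prob_dominates.
rewrite -(Radon_Nikodym_SigmaFinite.change_of_variables dom f0)//.
apply: ae_eq_integral => //.
- apply: emeasurable_funM => //; apply: (measurable_int mu).
  exact: Radon_Nikodym_SigmaFinite.f_integrable.
- apply: emeasurable_funM => //; apply/measurable_EFinP.
  exact: measurable_normal_pdf.
(* The Radon-Nikodym derivative and the density have equal integrals over every measurable set,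
   hence agree almost everywhere. *)
- apply: ae_eqe_mul2l; apply: integral_ae_eq => //=.
  + exact: Radon_Nikodym_SigmaFinite.f_integrable.
  + by apply/measurable_EFinP; exact: measurable_normal_pdf.
  + by move=> E _ mE; rewrite -(Radon_Nikodym_SigmaFinite.f_integral dom).
Qed.

(** Change of mean in dimension one: the factor is the ratio of the two normal densities. *)
Lemma integral_normal_shift m s t f : s != 0 ->
  (forall x, (0 <= f x)%E) -> measurable_fun setT f ->
  (\int[normal_prob (m + t) s]_x f x =
   \int[normal_prob m s]_x
     (f x * (expR (t * (x - m) / s ^+ 2 - t ^+ 2 / (2 * s ^+ 2)))%:E))%E.
Proof.
move=> s0 f0 mf; rewrite [LHS]integral_normal_prob//.
rewrite [RHS]integral_normal_prob; first last.
- apply: emeasurable_funM => //; apply/measurable_EFinP.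
  apply: measurableT_comp => //; apply: measurable_funB => //.
  apply: measurable_funM => //; apply: measurable_funM => //.
  exact: measurable_funB.
- by move=> x; rewrite mule_ge0// lee_fin expR_ge0.
apply: eq_integral => x _; rewrite -muleA -EFinM; congr (_ * _%:E)%E.
rewrite !normal_pdfE// mulrCA; congr (_ * _).
rewrite /normal_fun -expRD; congr expR; field.
by rewrite s0.
Qed.

(** The tilt turns the density with deviation [s] into [sqrt 2] times the density with deviation
    [sqrt 2 * s]. *)
Lemma integral_normal_expR_sqr m s : s != 0 ->
  (\int[normal_prob m s]_x (expR ((x - m) ^+ 2 / (4 * s ^+ 2)))%:E =
   (Num.sqrt 2)%:E)%E.
Proof.
move=> s0; rewrite integral_normal_prob//; last first.
  apply/measurable_EFinP.
  apply: measurableT_comp => //; apply: measurable_funM => //.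
  by apply: measurable_funX; exact: measurable_funB.
have s20 : Num.sqrt 2 * s != 0 by rewrite mulf_neq0// sqrtr_eq0 -ltNge.
have q2 : (Num.sqrt 2 : R) ^+ 2 = 2 by rewrite sqr_sqrtr.
transitivity (\int[mu]_x ((Num.sqrt 2)%:E *
    (normal_pdf m (Num.sqrt 2 * s) x)%:E))%E.
  apply: eq_integral => x _; rewrite -!EFinM; congr EFin.
  rewrite !normal_pdfE// mulrCA [RHS]mulrA; congr (_ * _).
    rewrite /normal_peak exprMn q2 -[in RHS]mulrA -[in RHS]mulrnAr sqrtrM//.
    by rewrite (invfM (Num.sqrt 2)) mulVKf// sqrtr_eq0 -ltNge.
  rewrite /normal_fun -expRD exprMn q2; congr expR; field.
  by rewrite s0.
rewrite ge0_integralZl//.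
- by rewrite integral_normal_pdf mule1.
- by apply/measurable_EFinP; exact: measurable_normal_pdf.
- by move=> x _; rewrite lee_fin normal_pdf_ge0.
Qed.

End normal_integrals.

(** * Integration against the Gaussian law on R^n *)

Section gaussian_integrals.
Context {R : realType}.
Implicit Types (s t : R).

Lemma gaussianS_integral n s (theta : n.+1.-tuple R)
    (f : n.+1.-tuple R -> \bar R) :
  (forall y, (0 <= f y)%E) -> measurable_fun setT f ->
  (\int[gaussian s theta]_y f y =
   \int[normal_prob (thead theta) s]_x
     \int[gaussian s [tuple of behead theta]]_y f (tcons (x, y)))%E.
Proof.
move=> f0 mf; rewrite /= /distribution.
rewrite (ge0_integral_pushforward (@measurable_tcons R n))//.
rewrite preimage_setT (fubini_tonelli1 (fun u => f (tcons u)))//.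
apply: measurableT_comp => //; exact: measurable_tcons.
Qed.

(* Unification otherwise unfolds the iterated product measure. *)
Opaque gaussian.

Lemma tnth_tcons0 n (x : measurableTypeR R) (y : n.-tuple R) :
  tnth (tcons (x, y)) ord0 = x.
Proof. by []. Qed.

Lemma tnth_tconsS n (x : measurableTypeR R) (y : n.-tuple R) i :
  tnth (tcons (x, y)) (lift ord0 i) = tnth y i.
Proof. exact: tnthS. Qed.

Lemma tnth_behead n (x : n.+1.-tuple R) i :
  tnth [tuple of behead x] i = tnth x (lift ord0 i).
Proof. by rewrite [in RHS](tuple_eta x) tnthS. Qed.

(** The density of the law with mean [theta + t e_i] relative to the law with mean [theta]. *)
Definition likelihood_ratio n s t (theta : n.-tuple R) (i : 'I_n)
    (y : n.-tuple R) : R :=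
  expR (t * (tnth y i - tnth theta i) / s ^+ 2 - t ^+ 2 / (2 * s ^+ 2)).

Lemma measurable_likelihood_ratio n s t (theta : n.-tuple R) i :
  measurable_fun setT (likelihood_ratio s t theta i).
Proof.
apply: measurableT_comp => //; apply: measurable_funB => //.
apply: measurable_funM => //; apply: measurable_funM => //.
by apply: measurable_funB => //; exact: measurable_tnth.
Qed.

Lemma likelihood_ratio_ge0 n s t (theta : n.-tuple R) i y :
  0 <= likelihood_ratio s t theta i y.
Proof. exact: expR_ge0. Qed.

Lemma gaussian_integral_shift n s t (theta theta' : n.-tuple R) i
    (f : n.-tuple R -> \bar R) :
  s != 0 -> (forall j, tnth theta' j = tnth theta j + t *+ (j == i)) ->
  (forall y, (0 <= f y)%E) -> measurable_fun setT f ->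
  (\int[gaussian s theta']_y f y =
   \int[gaussian s theta]_y (f y * (likelihood_ratio s t theta i y)%:E))%E.
Proof.
move=> s0; elim: n theta theta' i f => [|n IH] theta theta' i f.
  by case: i.
move=> tE f0 mf.
have mfL : measurable_fun setT
    (fun y => f y * (likelihood_ratio s t theta i y)%:E)%E.
  apply: emeasurable_funM => //; apply/measurable_EFinP.
  exact: measurable_likelihood_ratio.
have mtc x : measurable_fun setT (fun y : n.-tuple R => tcons (x, y)).
  by apply: measurableT_comp => //; exact: measurable_tcons.
have mftc x : measurable_fun setT (fun y : n.-tuple R => f (tcons (x, y))).
  exact: measurableT_comp.
have fL0 y : (0 <= f y * (likelihood_ratio s t theta i y)%:E)%E.
  by rewrite mule_ge0// lee_fin likelihood_ratio_ge0.
apply: (etrans (gaussianS_integral s theta' f0 mf)).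
apply: (etrans _ (esym (gaussianS_integral s theta fL0 mfL))).
case: (unliftP ord0 i) => [j ij|i0].
  have -> : thead theta' = thead theta.
    by rewrite /thead tE ij mulr0n addr0.
  apply: eq_integral => x _.
  have tjE k : tnth [tuple of behead theta'] k =
      tnth [tuple of behead theta] k + t *+ (k == j).
    by rewrite !tnth_behead tE ij (inj_eq lift_inj).
  have ftc0 y : (0 <= f (tcons (x, y)))%E by exact: f0.
  apply: (etrans (IH _ _ _ _ tjE ftc0 (mftc x))).
  by apply: eq_integral => y _; rewrite /likelihood_ratio ij tnth_tconsS tnth_behead.
have -> : thead theta' = thead theta + t by rewrite /thead tE i0 eqxx.
have -> : [tuple of behead theta'] = [tuple of behead theta].
  by apply: eq_from_tnth => k; rewrite !tnth_behead tE i0 eq_sym eq_liftF addr0.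
have mtcons := @measurable_tcons R n.
have F0 x : (0 <= \int[gaussian s [tuple of behead theta]]_y f (tcons (x, y)))%E.
  by apply: integral_ge0 => y _; exact: f0.
have mF := measurable_fun_fubini_tonelli_F
  (m2 := gaussian s [tuple of behead theta])
  (fun u => f (tcons u)) (measurableT_comp mf mtcons) (fun u => f0 _).
apply: (etrans (integral_normal_shift _ _ s0 F0 mF)).
apply: eq_integral => x _.
pose c := expR (t * (x - thead theta) / s ^+ 2 - t ^+ 2 / (2 * s ^+ 2)).
have c0 : (0 <= c%:E)%E by rewrite lee_fin expR_ge0.
apply: esym; transitivity
  (\int[gaussian s [tuple of behead theta]]_y (f (tcons (x, y)) * c%:E))%E.
  by apply: eq_integral => y _; rewrite /likelihood_ratio i0.
exact: (ge0_integralZr (gaussian s [tuple of behead theta]) measurableT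
  (mftc x) (fun y _ => f0 _) c0).
Qed.

Lemma gaussian_integral_tnth n s (theta : n.-tuple R) i
    (h : measurableTypeR R -> \bar R) :
  (forall x, (0 <= h x)%E) -> measurable_fun setT h ->
  (\int[gaussian s theta]_y h (tnth y i) =
   \int[normal_prob (tnth theta i) s]_x h x)%E.
Proof.
move=> h0 mh; elim: n theta i => [|n IH] theta i; first by case: i.
have mhi : measurable_fun setT (fun y : n.+1.-tuple R => h (tnth y i)).
  by apply: measurableT_comp => //; exact: measurable_tnth.
apply: (etrans (gaussianS_integral s theta (fun y => h0 (tnth y i)) mhi)).
case: (unliftP ord0 i) => [j ->|->].
  under eq_integral do under eq_integral do rewrite tnth_tconsS.
  under eq_integral do rewrite IH.
  by rewrite integral_cst//= probability_setT mule1 tnth_behead.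
under eq_integral do under eq_integral do rewrite tnth_tcons0.
apply: eq_integral => x _.
by rewrite integral_cst//= probability_setT mule1.
Qed.

End gaussian_integrals.

(** * Linearity and monotonicity for nonnegative real integrands *)

Section real_integrals.
Context d (T : measurableType d) (R : realType).
Variable mu : {measure set T -> \bar R}.
Implicit Types (f g : T -> R).

Lemma ge0_integral_EFinD f g : (forall x, 0 <= f x) -> measurable_fun setT f ->
  (forall x, 0 <= g x) -> measurable_fun setT g ->
  (\int[mu]_x (f x + g x)%:E = \int[mu]_x (f x)%:E + \int[mu]_x (g x)%:E)%E.
Proof.
move=> f0 mf g0 mg; rewrite -ge0_integralD//.
- by move=> x _; rewrite lee_fin.
- exact/measurable_EFinP.
- by move=> x _; rewrite lee_fin.
- exact/measurable_EFinP.
Qed.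

Lemma ge0_integral_EFinZ k f : 0 <= k -> (forall x, 0 <= f x) ->
  measurable_fun setT f ->
  (\int[mu]_x (k * f x)%:E = k%:E * \int[mu]_x (f x)%:E)%E.
Proof.
move=> k0 f0 mf; rewrite -ge0_integralZl_EFin//.
- by move=> x _; rewrite lee_fin.
- exact/measurable_EFinP.
Qed.

Lemma ge0_integral_EFin_sum (I : finType) (F : I -> T -> R) :
  (forall i x, 0 <= F i x) -> (forall i, measurable_fun setT (F i)) ->
  (\int[mu]_x (\sum_i F i x)%:E = \sum_i \int[mu]_x (F i x)%:E)%E.
Proof.
move=> F0 mF; under eq_integral do rewrite -sumEFin.
rewrite ge0_integral_sum//.
- by move=> i; exact/measurable_EFinP.
- by move=> i x _; rewrite lee_fin.
Qed.

Lemma ge0_le_integral_EFin f g : (forall x, 0 <= f x) -> measurable_fun setT f ->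
  measurable_fun setT g -> (forall x, f x <= g x) ->
  (\int[mu]_x (f x)%:E <= \int[mu]_x (g x)%:E)%E.
Proof.
move=> f0 mf mg fg; apply: ge0_le_integral => //.
- by move=> x _; rewrite lee_fin.
- exact/measurable_EFinP.
- exact/measurable_EFinP.
- by move=> x _; rewrite lee_fin.
Qed.

End real_integrals.

(** * First and second moments of the likelihood ratios *)

Section likelihood_moments.
Context {R : realType}.
Variables (n : nat) (s t : R).
Hypothesis s0 : s != 0.
Implicit Types (theta : n.-tuple R).

Lemma integral_likelihood_ratio theta i :
  (\int[gaussian s theta]_y (likelihood_ratio s t theta i y)%:E = 1%:E)%E.
Proof.
pose theta' := [tuple tnth theta j + t *+ (j == i) | j < n].
have tE j : tnth theta' j = tnth theta j + t *+ (j == i) by rewrite tnth_mktuple.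
have := gaussian_integral_shift (f := fun=> 1%E) s0 tE (fun=> lee01)
  (measurable_cst _).
rewrite integral_cst//= probability_setT mule1 => ->.
by apply: eq_integral => y _; rewrite mul1e.
Qed.

(** The factor at [j] is absorbed by moving the mean to [theta']. If [i = j], recentring the other
    factor at [theta'] releases the constant [exp (t^2 / s^2)]; otherwise it is unchanged. What
    remains has mean 1. *)
Lemma integral_likelihood_ratioM theta i j :
  (\int[gaussian s theta]_y
     (likelihood_ratio s t theta i y * likelihood_ratio s t theta j y)%:E =
   (if i == j then expR (t ^+ 2 / s ^+ 2) else 1)%:E)%E.
Proof.
pose theta' := [tuple tnth theta k + t *+ (k == j) | k < n].
have tE k : tnth theta' k = tnth theta k + t *+ (k == j) by rewrite tnth_mktuple.
have mLi : measurable_fun setT (fun y => (likelihood_ratio s t theta i y)%:E).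
  by apply/measurable_EFinP; exact: measurable_likelihood_ratio.
have := gaussian_integral_shift
  (f := fun y => (likelihood_ratio s t theta i y)%:E) s0 tE
  (fun y => likelihood_ratio_ge0 s t theta i y)
  mLi.
under [in RHS]eq_integral do rewrite -EFinM.
move=> <-; case: eqVneq => [->|ij].
  transitivity (\int[gaussian s theta']_y
      (expR (t ^+ 2 / s ^+ 2) * likelihood_ratio s t theta' j y)%:E)%E.
    apply: eq_integral => y _; congr EFin.
    rewrite /likelihood_ratio -expRD tE eqxx mulr1n; congr expR; field.
    by rewrite s0.
  rewrite ge0_integral_EFinZ ?expR_ge0//.
  - by rewrite integral_likelihood_ratio mule1.
  - exact: likelihood_ratio_ge0.
  - exact: measurable_likelihood_ratio.
apply: etrans _ (integral_likelihood_ratio theta' i).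
by apply: eq_integral => y _; rewrite /likelihood_ratio tE (negbTE ij) addr0.
Qed.

End likelihood_moments.

(** * Minimax lower bound for sparse vectors *)

Section block_bayes_risk.
Context {R : realType}.
Variables (n m : nat) (s tau : R) (est : n.-tuple R -> n.-tuple R).
Variables (e : 'I_m -> 'I_n).
Hypotheses (s0 : s != 0) (tau0 : 0 <= tau) (m0 : (0 < m)%N).
Hypotheses (mest : measurable_fun setT est) (inj_e : injective e).
Hypothesis tau_le : expR (tau ^+ 2 / s ^+ 2) <= m.+1%:R.
Implicit Types (theta eta : n.-tuple R).

(** Restricted to the places of one block, so that the losses of disjoint blocks add up to at most
    the full loss. *)
Definition block_loss theta (y : n.-tuple R) : R :=
  \sum_(j < m) (tnth (est y) (e j) - tnth theta (e j)) ^+ 2.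

Definition block_risk theta : \bar R :=
  (\int[gaussian s theta]_y (block_loss theta y)%:E)%E.

Lemma block_loss_ge0 theta y : 0 <= block_loss theta y.
Proof. by apply: sumr_ge0 => j _; exact: sqr_ge0. Qed.

Lemma measurable_block_loss theta : measurable_fun setT (block_loss theta).
Proof.
apply: measurable_sum => j; apply: measurable_funX; apply: measurable_funB => //.
exact: measurableT_comp (measurable_tnth (e j)) mest.
Qed.

Variables (eta : n.-tuple R) (th : 'I_m -> n.-tuple R).
Hypothesis eta0 : forall j, tnth eta (e j) = 0.
Hypothesis thE : forall j i, tnth (th j) i = tnth eta i + tau *+ (i == e j).

(** All risks are written under the law at [eta]; the weight [L j] produces the law at [th j]. *)
Let L j y := likelihood_ratio s tau eta (e j) y.

Let L_ge0 j y : 0 <= L j y. Proof. exact: likelihood_ratio_ge0. Qed.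

Let mL j : measurable_fun setT (L j).
Proof. exact: measurable_likelihood_ratio. Qed.

(** [S / m] is the likelihood ratio of the uniform mixture of the [th j] against [eta]. *)
Let S y := \sum_(j < m) L j y.

Let S_ge0 y : 0 <= S y. Proof. by apply: sumr_ge0 => j _. Qed.

Let mS : measurable_fun setT S. Proof. exact: measurable_sum. Qed.

Let integral_S : (\int[gaussian s eta]_y (S y)%:E = m%:R%:E)%E.
Proof.
rewrite ge0_integral_EFin_sum//.
under eq_bigr do rewrite integral_likelihood_ratio//.
by rewrite sumEFin sumr_const card_ord.
Qed.

(** In the double sum each of the [m] rows has one diagonal term, at most [m + 1] by [tau_le], and
    [m - 1] off-diagonal terms equal to 1, hence a total of at most [2 m]. *)
Let integral_S2 : (\int[gaussian s eta]_y (S y ^+ 2)%:E <= (2 * m%:R ^+ 2)%:E)%E.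
Proof.
have mLL j k : measurable_fun setT (fun y => L j y * L k y).
  exact: measurable_funM.
have LL0 j k y : 0 <= L j y * L k y by exact: mulr_ge0.
have -> : (\int[gaussian s eta]_y (S y ^+ 2)%:E =
    (\sum_(j < m) \sum_(k < m)
       (if e j == e k then expR (tau ^+ 2 / s ^+ 2) else 1))%:E)%E.
  under eq_integral do rewrite expr2 big_distrlr/=.
  rewrite ge0_integral_EFin_sum; last 2 first.
  - by move=> j y; apply: sumr_ge0 => k _; exact: LL0.
  - by move=> j; apply: measurable_sum => k; exact: mLL.
  rewrite -sumEFin; apply: eq_bigr => j _.
  rewrite (ge0_integral_EFin_sum _ (LL0 j) (mLL j)) -sumEFin.
  by apply: eq_bigr => k _; exact: integral_likelihood_ratioM.
have -> : 2 * m%:R ^+ 2 = \sum_(j < m) (2 * m%:R) :> R.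
  by rewrite sumr_const card_ord -[RHS]mulr_natl; ring.
rewrite lee_fin.
apply: ler_sum => j _; rewrite (bigD1 j)//= eqxx.
have -> : \sum_(k < m | k != j) (if e j == e k then expR (tau ^+ 2 / s ^+ 2)
    else 1) = m.-1%:R :> R.
  rewrite (eq_bigr (fun=> 1)) => [|k kj].
    by rewrite sumr_const cardC1 card_ord.
  by rewrite (inj_eq inj_e) eq_sym (negbTE kj).
have -> : 2 * m%:R = m.+1%:R + m.-1%:R :> R.
  by rewrite -natrD -natrM; congr _%:R; case: (m) m0 => // k _; rewrite /=; lia.
by rewrite lerD2r.
Qed.

(* Either the loss at [eta] or the loss at every [th j] is at least
   [tau^2 / 4]; the right-hand side then follows from
   [min 1 u >= u - u^2 / 4] with [u = S y / m]. *)
Let block_loss_lower y : tau ^+ 2 / 4 * S y <=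
  (m%:R * block_loss eta y + \sum_(j < m) block_loss (th j) y * L j y) +
  tau ^+ 2 / (16 * m%:R) * S y ^+ 2.
Proof.
have mR : 0 < m%:R :> R by rewrite ltr0n.
have sum0 : 0 <= \sum_(j < m) block_loss (th j) y * L j y.
  by apply: sumr_ge0 => j _; rewrite mulr_ge0// block_loss_ge0.
have [big|small] := leP (tau ^+ 2 / 4) (block_loss eta y).
  have : m%:R * (tau ^+ 2 / 4) <= m%:R * block_loss eta y by rewrite ler_pM2l.
  (* Equality in [u - u^2 / 4 <= 1] holds at [u = 2], so the square is centred at [S = 2 m]. *)
  have : 0 <= tau ^+ 2 / (16 * m%:R) * (S y - 2 * m%:R) ^+ 2.
    by rewrite mulr_ge0 ?sqr_ge0// divr_ge0 ?sqr_ge0// mulr_ge0// ltW.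
  have -> : tau ^+ 2 / (16 * m%:R) * (S y - 2 * m%:R) ^+ 2 =
      tau ^+ 2 / (16 * m%:R) * S y ^+ 2 - tau ^+ 2 / 4 * S y
      + m%:R * (tau ^+ 2 / 4).
    by field; rewrite gt_eqF.
  lra.
(* A small loss at [eta] keeps every estimated coordinate of the block below [tau / 2], so a spike
   of height [tau] is missed by at least [tau / 2]. *)
have losses j : tau ^+ 2 / 4 <= block_loss (th j) y.
  rewrite /block_loss (bigD1 j)//= thE eqxx eta0 add0r mulr1n.
  apply: ler_wpDr; first by apply: sumr_ge0 => k _; exact: sqr_ge0.
  set u := tnth (est y) (e j).
  have : u ^+ 2 < tau ^+ 2 / 4.
    apply: le_lt_trans small; rewrite /block_loss (bigD1 j)//= eta0 subr0.
    by rewrite lerDl; apply: sumr_ge0 => k _; exact: sqr_ge0.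
  move=> u2; have u_le : u <= tau / 2.
    rewrite leNgt; apply/negP => ut.
    have : (tau / 2) ^+ 2 < u ^+ 2.
      by rewrite ltrXn2r// ?nnegrE ?divr_ge0// (le_trans _ (ltW ut))// divr_ge0.
    by rewrite expr_div_n => ?; lra.
  have : (tau / 2) ^+ 2 <= (tau - u) ^+ 2.
    by apply: lerXn2r; rewrite ?nnegrE; move: tau0 u_le; lra.
  rewrite expr_div_n -[(tau - u) ^+ 2]sqrrN opprB => ?; lra.
apply: (@le_trans _ _ (\sum_(j < m) block_loss (th j) y * L j y)).
  rewrite /S mulr_sumr; apply: ler_sum => j _.
  by apply: ler_wpM2r.
rewrite -addrA addrCA lerDl addr_ge0//.
  by rewrite mulr_ge0// block_loss_ge0.
by rewrite mulr_ge0 ?sqr_ge0// divr_ge0 ?sqr_ge0// mulr_ge0// ltW.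
Qed.

(* [eta] and the mixture of the [th j] have equal prior weight. *)
Lemma block_bayes_risk :
  ((m%:R * tau ^+ 2 / 8)%:E <=
   m%:R%:E * block_risk eta + \sum_(j < m) block_risk (th j))%E.
Proof.
have mR : 0 < m%:R :> R by rewrite ltr0n.
have c0 : 0 <= tau ^+ 2 / (16 * m%:R).
  by rewrite divr_ge0 ?sqr_ge0// mulr_ge0// ltW.
have BL0 j y : 0 <= block_loss (th j) y * L j y.
  by rewrite mulr_ge0// block_loss_ge0.
have mBL j : measurable_fun setT (fun y => block_loss (th j) y * L j y).
  by apply: measurable_funM => //; exact: measurable_block_loss.
have mB0 : measurable_fun setT (fun y => m%:R * block_loss eta y).
  by apply: measurable_funM => //; exact: measurable_block_loss.
have B00 y : 0 <= m%:R * block_loss eta y.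
  by rewrite mulr_ge0// block_loss_ge0.
have mBLs : measurable_fun setT
    (fun y => \sum_(j < m) block_loss (th j) y * L j y).
  exact: measurable_sum.
have BLs0 y : 0 <= \sum_(j < m) block_loss (th j) y * L j y.
  exact: sumr_ge0.
have mS2 : measurable_fun setT (fun y => S y ^+ 2) by exact: measurable_funX.
have S20 y : 0 <= S y ^+ 2 by exact: sqr_ge0.
have thR j : block_risk (th j) =
    (\int[gaussian s eta]_y (block_loss (th j) y * L j y)%:E)%E.
  have mb : measurable_fun setT (fun y => (block_loss (th j) y)%:E).
    by apply/measurable_EFinP; exact: measurable_block_loss.
  have b0 y : (0 <= (block_loss (th j) y)%:E)%E by rewrite lee_fin block_loss_ge0.
  apply: (etrans (gaussian_integral_shift s0 (thE j) b0 mb)).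
  by apply: eq_integral => y _; rewrite EFinM.
have int_le : (\int[gaussian s eta]_y (tau ^+ 2 / 4 * S y)%:E <=
    \int[gaussian s eta]_y
      ((m%:R * block_loss eta y + \sum_(j < m) block_loss (th j) y * L j y) +
        tau ^+ 2 / (16 * m%:R) * S y ^+ 2)%:E)%E.
  apply: ge0_le_integral_EFin => //.
  - by move=> y; rewrite mulr_ge0// divr_ge0// sqr_ge0.
  - exact: measurable_funM.
  - apply: measurable_funD; first exact: measurable_funD.
    exact: measurable_funM.
move: int_le; rewrite ge0_integral_EFinZ//; last by rewrite divr_ge0// sqr_ge0.
rewrite integral_S ge0_integral_EFinD; last 4 first.
- by move=> y; rewrite addr_ge0.
- exact: measurable_funD.
- by move=> y; rewrite mulr_ge0.
- exact: measurable_funM.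
rewrite ge0_integral_EFinD// ge0_integral_EFin_sum//.
rewrite ge0_integral_EFinZ//; last 2 first.
- exact: block_loss_ge0.
- exact: measurable_block_loss.
rewrite ge0_integral_EFinZ// -/(block_risk eta).
under eq_bigr do rewrite -thR.
(* The first moment of [S] gives [m tau^2 / 4]; the second costs
   [tau^2 / (16 m) * 2 m^2 = m tau^2 / 8]. The cost is cancelled by adding it to both sides, since
   the risks may be infinite. *)
move=> int_le; have {int_le} := le_trans int_le (leeD2l _
  (lee_wpmul2l (c0 : (0 <= _%:E)%E) integral_S2)).
rewrite -!EFinM => int_le.
rewrite -(@leeD2rE _ (m%:R * tau ^+ 2 / 8)%:E)//.
apply: le_trans (le_trans int_le _); last first.
  apply: leeD2l; rewrite lee_fin le_eqVlt; apply/orP; left; apply/eqP.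
  by field; rewrite gt_eqF.
by rewrite -EFinD lee_fin le_eqVlt; apply/orP; left; apply/eqP; field.
Qed.

End block_bayes_risk.

(** * Resampling one coordinate of a uniform function *)

Section update_average.
Context {I V : finType}.

Definition ffun_update (f : {ffun I -> V}) b v : {ffun I -> V} :=
  [ffun c => if c == b then v else f c].

(** Exchanging the value at [b] with [v] is an involution on pairs [(f, v)]; after this reindexing
    [v] no longer appears in the summand. *)
Lemma sum_ffun_update (R : pzSemiRingType) (G : {ffun I -> V} -> R) b :
  \sum_f \sum_v G (ffun_update f b v) = #|V|%:R * \sum_f G f.
Proof.
pose h (u : {ffun I -> V} * V) := (ffun_update u.1 b u.2, u.1 b).
have hK : involutive h.
  move=> [f v]; rewrite /h/= ffunE eqxx; congr pair.
  by apply/ffunP => c; rewrite !ffunE; case: eqP => [->|].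
rewrite pair_bigA/= (reindex_inj (inv_inj hK))/=.
under eq_bigr => u _ do rewrite -[X in G X]/((h (h u)).1) hK.
rewrite -(pair_bigA _ (fun f _ => G f))/=.
under eq_bigr do rewrite sumr_const -mulr_natl.
by rewrite mulr_sumr.
Qed.

End update_average.

(** * The prior with independent blocks *)

Section spikes_design.
Context {R : realType}.
Variables (n k m : nat) (s tau : R) (e : 'I_k -> 'I_m -> 'I_n).
Hypothesis inj_e : forall b j b' j', e b j = e b' j' -> b = b' /\ j = j'.
Implicit Types (f : {ffun 'I_k -> bool * 'I_m}).

(* [f b = (true, j)] puts a spike at place [j] of block [b]; [(false, _)] leaves
   the block empty, so a uniform [f] is the prior of the lower bound. *)
Definition spikes f : n.-tuple R :=
  [tuple \sum_(b < k) tau *+ ((f b).1 && (i == e b (f b).2)) | i < n].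

Lemma tnth_spikes f b j : tnth (spikes f) (e b j) = tau *+ (f b == (true, j)).
Proof.
rewrite tnth_mktuple (bigD1 b)//= big1 ?addr0 => [|c cb].
  case: (f b) => [[] l]; rewrite xpair_eqE//= eq_sym.
  by congr (_ *+ nat_of_bool _); apply/eqP/eqP => [/inj_e[]//|->].
case: eqP => [/inj_e[bc _]|]; last by rewrite andbF.
by rewrite bc eqxx in cb.
Qed.

Lemma spikes_values f i : tnth (spikes f) i = 0 \/ tnth (spikes f) i = tau.
Proof.
have [[b /eqP ->]|noe] := pselect (exists b, i == e b (f b).2).
  by rewrite tnth_spikes; case: eqP => _; [right|left].
left; rewrite tnth_mktuple big1// => b _.
by case: eqP => [ie|]; rewrite ?andbF//; case: noe; exists b; apply/eqP.
Qed.

Lemma l0_norm_spikes f : (l0_norm (spikes f) <= k)%N.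
Proof.
apply: (@leq_trans #|[set e b (f b).2 | b : 'I_k]|).
  rewrite /l0_norm; apply: subset_leq_card; apply/fintype.subsetP => i.
  rewrite !inE.
  apply: contraNT => /imsetP noe.
  rewrite tnth_mktuple big1// => b _.
  by case: eqP => [ie|]; rewrite ?andbF//; case: noe; exists b.
by rewrite (leq_trans (leq_imset_card _ _))// card_ord.
Qed.

(** The place is a dummy in an empty block: [m] of the [2 m] values of [f b] encode the empty block,
    which gives it prior weight 1/2. *)
Lemma spikes_update_false f b j j' :
  spikes (ffun_update f b (false, j)) = spikes (ffun_update f b (false, j')).
Proof.
apply: eq_from_tnth => i; rewrite !tnth_mktuple; apply: eq_bigr => c _.
by rewrite !ffunE; case: eqP.
Qed.

Lemma spikes_update_true f b j j' i :
  tnth (spikes (ffun_update f b (true, j))) i =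
  tnth (spikes (ffun_update f b (false, j'))) i + tau *+ (i == e b j).
Proof.
rewrite !tnth_mktuple (bigD1 b)//= [in RHS](bigD1 b)//= !ffunE eqxx/= add0r addrC.
congr (_ + _); apply: eq_bigr => c /negbTE cb.
by rewrite !ffunE cb.
Qed.

Hypotheses (s0 : s != 0) (tau0 : 0 <= tau) (m0 : (0 < m)%N).
Hypothesis tau_le : expR (tau ^+ 2 / s ^+ 2) <= m.+1%:R.

Variable est : n.-tuple R -> n.-tuple R.
Hypothesis mest : measurable_fun setT est.

(** The blocks occupy disjoint sets of coordinates, and the coordinates outside them only add to the
    loss. *)
Lemma sum_block_risk_le theta :
  (\sum_(b < k) block_risk s est (e b) theta <= risk s est theta)%E.
Proof.
rewrite /block_risk -ge0_integral_EFin_sum; last 2 first.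
- by move=> b y; exact: block_loss_ge0.
- by move=> b; exact: measurable_block_loss.
apply: ge0_le_integral_EFin.
- by move=> y; apply: sumr_ge0 => b _; exact: block_loss_ge0.
- by apply: measurable_sum => b; exact: measurable_block_loss.
- apply: measurable_sum => i; apply: measurable_funX; apply: measurable_funB => //.
  exact: measurableT_comp (measurable_tnth i) mest.
- move=> y; rewrite /block_loss pair_bigA/= /sqdist.
  rewrite -(big_imset (h := fun u : 'I_k * 'I_m => e u.1 u.2)
    (fun i => (tnth (est y) i - tnth theta i) ^+ 2))/=; last first.
    by move=> [b j] [b' j'] _ _ /= /inj_e[-> ->].
  rewrite [leRHS](bigID (mem [set e u.1 u.2 | u : 'I_k * 'I_m]))/=.
  by rewrite lerDl sumr_ge0// => i _; exact: sqr_ge0.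
Qed.

Lemma block_risk_ge0 (b : 'I_k) theta : (0 <= block_risk s est (e b) theta)%E.
Proof. by apply: integral_ge0 => y _; rewrite lee_fin block_loss_ge0. Qed.

(** The worst risk dominates the average over all [f]. In that average block [b] may be resampled
    with the others frozen, and [block_bayes_risk] bounds the sum over its [2 m] values by
    [m tau^2 / 8] from below, that is [tau^2 / 16] per block on average. *)
Lemma worst_risk_spikes (Theta : set (n.-tuple R)) :
  (forall f, Theta (spikes f)) ->
  ((k%:R * tau ^+ 2 / 16)%:E <= worst_risk Theta s est)%E.
Proof.
move=> Theta_spikes.
have risk_le f : (risk s est (spikes f) <= worst_risk Theta s est)%E.
  by apply: ereal_sup_ubound; exists (spikes f).
have f0 : {ffun 'I_k -> bool * 'I_m} := [ffun=> (true, Ordinal m0)].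
case: (worst_risk Theta s est) risk_le => [w||] risk_le; last 2 first.
- by rewrite leey.
- have := le_trans (sum_block_risk_le (spikes f0)) (risk_le f0).
  by rewrite leeNy_eq => /eqP sumE; have : (0 <= -oo :> \bar R)%E
    by rewrite -sumE; apply: sume_ge0 => b _; exact: block_risk_ge0.
(* The worst risk is now a real [w], so all block risks are finite and the averaging takes place in
   [R]. *)
pose G b f := fine (block_risk s est (e b) (spikes f)).
have GE b f : block_risk s est (e b) (spikes f) = (G b f)%:E.
  rewrite fineK// ge0_fin_numE ?block_risk_ge0//.
  apply: le_lt_trans (ltry w); apply: le_trans (risk_le f).
  apply: le_trans (sum_block_risk_le (spikes f)).
  rewrite (bigD1 b)//= leeDl// sume_ge0// => c _; exact: block_risk_ge0.
have sumG f : \sum_b G b f <= w.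
  rewrite -lee_fin -sumEFin; under eq_bigr do rewrite -GE.
  exact: le_trans (sum_block_risk_le (spikes f)) (risk_le f).
have avgG b f : m%:R * tau ^+ 2 / 8 <= \sum_v G b (ffun_update f b v).
  rewrite (eq_bigr (fun v => G b (ffun_update f b (v.1, v.2)))) => [|[]//].
  rewrite -(pair_bigA _ (fun u j => G b (ffun_update f b (u, j))))/= big_bool/=.
  pose eta := spikes (ffun_update f b (false, Ordinal m0)).
  have eta0 j : tnth eta (e b j) = 0 by rewrite tnth_spikes ffunE eqxx.
  have inj_eb : injective (e b) by move=> j j' /inj_e[].
  have := block_bayes_risk (th := fun j => spikes (ffun_update f b (true, j)))
    s0 tau0 m0 mest inj_eb tau_le eta0
    (fun j i => spikes_update_true f b j (Ordinal m0) i).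
  rewrite GE (eq_bigr _ (fun j _ => GE b _)).
  rewrite sumEFin -EFinM -EFinD lee_fin [leRHS]addrC => /le_trans; apply.
  rewrite lerD2l (eq_bigr (fun=> G b (ffun_update f b (false, Ordinal m0)))).
    by rewrite sumr_const card_ord mulr_natl.
  by move=> j _; rewrite /G (spikes_update_false f b j (Ordinal m0)).
have N0 : 0 < #|{ffun 'I_k -> bool * 'I_m}|%:R :> R.
  by rewrite ltr0n; apply/card_gt0P; exists f0.
set N := #|_|%:R in N0.
have sumN (x : R) : N * x = \sum_(f : {ffun 'I_k -> bool * 'I_m}) x.
  by rewrite sumr_const mulr_natl.
have sumk (x : R) : k%:R * x = \sum_(b < k) x.
  by rewrite sumr_const card_ord mulr_natl.
have sumG_ge b : N * (m%:R * tau ^+ 2 / 8) <= (2 * m)%:R * \sum_f G b f.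
  have := sum_ffun_update (G b) b; rewrite card_prod card_bool card_ord => <-.
  by rewrite sumN; apply: ler_sum => f _; exact: avgG.
have : \sum_b \sum_f G b f <= N * w.
  by rewrite exchange_big/= sumN; exact: ler_sum.
have : k%:R * (N * (m%:R * tau ^+ 2 / 8)) <= (2 * m)%:R * \sum_b \sum_f G b f.
  by rewrite sumk mulr_sumr; exact: ler_sum.
rewrite natrM => le1 le2; rewrite lee_fin.
have mR : 0 < m%:R :> R by rewrite ltr0n.
rewrite -(ler_pM2l N0) -(ler_pM2l mR).
have := ler_wpM2l (ltW mR) le2; move: le1; lra.
Qed.

End spikes_design.

Lemma minimax_risk_sparse_ge {R : realType} (n k : nat) (s tau : R)
    (Theta : set (n.-tuple R)) :
  (0 < k <= n)%N -> s != 0 -> 0 <= tau ->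
  expR (tau ^+ 2 / s ^+ 2) <= (n %/ k).+1%:R ->
  (forall theta : n.-tuple R, (l0_norm theta <= k)%N ->
    (forall i, tnth theta i = 0 \/ tnth theta i = tau) -> Theta theta) ->
  ((k%:R * tau ^+ 2 / 16)%:E <= minimax_risk Theta s)%E.
Proof.
move=> /andP[k0 kn] s0 tau0 tau_le ThetaP.
have m0 : (0 < n %/ k)%N by rewrite divn_gt0.
have lt_n (b : 'I_k) (j : 'I_(n %/ k)) : (b * (n %/ k) + j < n)%N.
  apply: (@leq_trans (b.+1 * (n %/ k))); first by rewrite mulSn addnC ltn_add2r.
  apply: leq_trans (leq_trunc_div n k); rewrite [leqRHS]mulnC leq_mul2r.
  by rewrite ltn_ord orbT.
(* Consecutive blocks of length [n %/ k]; quotient and remainder recover the block and the place. *)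
pose e b j := Ordinal (lt_n b j).
have inj_e b j b' j' : e b j = e b' j' -> b = b' /\ j = j'.
  move=> /(congr1 (@nat_of_ord _))/= eq_e.
  have := congr1 (fun i => i %/ (n %/ k))%N eq_e.
  have := congr1 (fun i => i %% (n %/ k))%N eq_e.
  rewrite /= !modnMDl !divnMDl// !modn_small//.
  rewrite (divn_small (ltn_ord j)) (divn_small (ltn_ord j')) !addn0.
  by move=> jj bb; split; exact: val_inj.
apply: le_ereal_inf_tmp => _ [est mest <-].
apply: (worst_risk_spikes inj_e) => // f.
apply: ThetaP; first exact: l0_norm_spikes.
exact: spikes_values.
Qed.

(** * Risk of the projection *)

Section mle_risk.
Context {R : realType}.
Variables (n : nat) (s : R).
Hypothesis s0 : 0 < s.
Variables (Theta : set (n.-tuple R)) (Pi : n.-tuple R -> n.-tuple R).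
Hypothesis mle : is_mle Theta Pi.

(** [theta] competes in the minimisation defining [Pi y]; expanding both squared distances around
    [theta] gives the claim for any [Theta], convex or not. *)
Lemma mle_basic_inequality theta y : Theta theta ->
  sqdist (Pi y) theta <=
  \sum_(i < n) 2 * (tnth y i - tnth theta i) * (tnth (Pi y) i - tnth theta i).
Proof.
move=> /(mle.2 y).2; rewrite /sqdist -subr_ge0 -sumrB => le0.
rewrite -subr_ge0 -sumrB; apply: le_trans le0 _.
by apply: ler_sum => i _; lra.
Qed.

(* The exponential dominates [x^2] on [|x| > tau] and, unlike that truncated
   square, has an explicit Gaussian mean. *)
Lemma cross_term_le (tau x D : R) : 0 <= tau ->
  2 * x * D <= D ^+ 2 / 2 + 2 * tau * Num.min `|D| tau +
    16 * s ^+ 2 * expR ((2 * x ^+ 2 - tau ^+ 2) / (8 * s ^+ 2)).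
Proof.
move=> tau0; have s20 : 0 < s ^+ 2 by rewrite exprn_gt0.
have amgm : 2 * x * D <= D ^+ 2 / 2 + 2 * x ^+ 2.
  have : 0 <= (D - 2 * x) ^+ 2 by exact: sqr_ge0.
  by rewrite sqrrB => ?; lra.
have min0 : 0 <= 2 * tau * Num.min `|D| tau.
  by rewrite !mulr_ge0// le_min normr_ge0.
(* Above the level, [2 x^2 - tau^2 > x^2], so the exponential term alone dominates [2 x^2]. *)
have [x_le|x_gt] := leP `|x| tau; last first.
  have x2_gt : tau ^+ 2 < x ^+ 2.
    by rewrite -(real_normK (num_real x)) ltrXn2r// nnegrE.
  have : x ^+ 2 / (8 * s ^+ 2) <=
      expR ((2 * x ^+ 2 - tau ^+ 2) / (8 * s ^+ 2)).
    apply: (@le_trans _ _ (expR (x ^+ 2 / (8 * s ^+ 2)))).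
      by apply: le_trans (expR_ge1Dx _); rewrite lerDr.
    by rewrite ler_expR ler_pM2r ?invr_gt0 ?mulr_gt0//; lra.
  rewrite ler_pdivrMr ?mulr_gt0// => x2_le; lra.
have exp0 : 0 <= 16 * s ^+ 2 * expR ((2 * x ^+ 2 - tau ^+ 2) / (8 * s ^+ 2)).
  by rewrite !mulr_ge0 ?expR_ge0// ltW.
suff : 2 * x * D <= D ^+ 2 / 2 + 2 * tau * Num.min `|D| tau by lra.
(* The two branches of the minimum: [2 x D <= 2 tau |D|], or [2 x^2 <= 2 tau^2] after [amgm]. *)
have [D_le|D_gt] := leP `|D| tau.
  apply: (@le_trans _ _ (2 * tau * `|D|)); last by rewrite lerDr divr_ge0// sqr_ge0.
  rewrite -!mulrA ler_pM2l//; apply: le_trans (ler_norm _) _.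
  by rewrite normrM ler_wpM2r.
apply: le_trans amgm _; rewrite lerD2l -mulrA ler_pM2l// -expr2.
by rewrite -(real_normK (num_real x)) lerXn2r// nnegrE.
Qed.

(** What is left of the exponentials in [cross_term_le] once [exp (- tau^2 / (8 s^2))] is factored
    out. *)
Let noise theta (y : n.-tuple R) : R :=
  \sum_(i < n) expR ((tnth y i - tnth theta i) ^+ 2 / (4 * s ^+ 2)).

Let noise_ge0 theta y : 0 <= noise theta y.
Proof. by apply: sumr_ge0 => i _; exact: expR_ge0. Qed.

Let measurable_noise theta : measurable_fun setT (noise theta).
Proof.
apply: measurable_sum => i; apply: measurableT_comp => //.
apply: measurable_funM => //; apply: measurable_funX.
by apply: measurable_funB => //; exact: measurable_tnth.
Qed.

Let integral_noise theta :
  (\int[gaussian s theta]_y (noise theta y)%:E = (n%:R * Num.sqrt 2)%:E)%E.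
Proof.
rewrite ge0_integral_EFin_sum; last 2 first.
- by move=> i y; exact: expR_ge0.
- move=> i; apply: measurableT_comp => //.
  apply: measurable_funM => //; apply: measurable_funX.
  by apply: measurable_funB => //; exact: measurable_tnth.
have h0 i (x : measurableTypeR R) :
    (0 <= (expR ((x - tnth theta i) ^+ 2 / (4 * s ^+ 2)))%:E)%E.
  by rewrite lee_fin expR_ge0.
have mh i : measurable_fun setT (fun x : measurableTypeR R =>
    (expR ((x - tnth theta i) ^+ 2 / (4 * s ^+ 2)))%:E).
  apply/measurable_EFinP; apply: measurableT_comp => //.
  apply: measurable_funM => //; apply: measurable_funX.
  exact: measurable_funB.
rewrite (eq_bigr (fun=> (Num.sqrt 2)%:E)) => [|i _].
  by rewrite sumEFin sumr_const card_ord mulr_natl.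
apply: (etrans (gaussian_integral_tnth s theta i (h0 i) (mh i))).
by apply: integral_normal_expR_sqr; rewrite gt_eqF.
Qed.

(** Sum [cross_term_le] over the coordinates: half of the squared error is absorbed on the left,
    which doubles the constants, and [A] bounds the truncated distance from [Pi y] to [theta]. *)
Lemma worst_risk_mle_le (tau A : R) : 0 <= tau ->
  (forall x y, Theta x -> Theta y ->
    \sum_(i < n) Num.min `|tnth x i - tnth y i| tau <= A) ->
  (worst_risk Theta s Pi <=
   (4 * tau * A +
     32 * s ^+ 2 * (n%:R * Num.sqrt 2) * expR (- tau ^+ 2 / (8 * s ^+ 2)))%:E)%E.
Proof.
move=> tau0 A_le; apply: ge_ereal_sup => _ [theta Theta_theta <-].
have A0 : 0 <= A.
  apply: le_trans (A_le theta theta Theta_theta Theta_theta).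
  by apply: sumr_ge0 => i _; rewrite le_min normr_ge0.
set E := expR (- tau ^+ 2 / (8 * s ^+ 2)).
have c0 : 0 <= 32 * s ^+ 2 * E by rewrite !mulr_ge0 ?expR_ge0// ltW// exprn_gt0.
have mc : measurable_fun setT (fun y => 32 * s ^+ 2 * E * noise theta y).
  exact: measurable_funM.
apply: (@le_trans _ _ (\int[gaussian s theta]_y
    (4 * tau * A + 32 * s ^+ 2 * E * noise theta y)%:E)%E).
  apply: ge0_le_integral_EFin.
  - by move=> y; apply: sumr_ge0 => i _; exact: sqr_ge0.
  - apply: measurable_sum => i; apply: measurable_funX.
    apply: measurable_funB => //.
    exact: measurableT_comp (measurable_tnth i) mle.1.
  - exact: measurable_funD.
  move=> y; have le1 := mle_basic_inequality y Theta_theta.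
  have {le1} := le_trans le1 (ler_sum _ (fun i _ => cross_term_le
    (tnth y i - tnth theta i) (tnth (Pi y) i - tnth theta i) tau0)).
  rewrite !big_split/= -mulr_suml -/(sqdist (Pi y) theta) -mulr_sumr.
  have -> : \sum_(i < n) 16 * s ^+ 2 *
      expR ((2 * (tnth y i - tnth theta i) ^+ 2 - tau ^+ 2) / (8 * s ^+ 2)) =
      16 * s ^+ 2 * E * noise theta y.
    rewrite mulr_sumr; apply: eq_bigr => i _.
    rewrite -[RHS]mulrA -expRD; congr (_ * expR _).
    by field; rewrite gt_eqF.
  have := ler_wpM2l (mulr_ge0 (ler0n R 2) tau0)
    (A_le _ _ (mle.2 y).1 Theta_theta).
  lra.
rewrite ge0_integral_EFinD//; last 2 first.
- by move=> y; rewrite !mulr_ge0.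
- by move=> y; rewrite mulr_ge0.
rewrite integral_cst//= probability_setT mule1 ge0_integral_EFinZ//.
rewrite integral_noise -EFinM -EFinD lee_fin le_eqVlt; apply/orP; left.
by apply/eqP; ring.
Qed.

Lemma worst_risk_mle_le_diam (D : R) :
  (forall x y, Theta x -> Theta y -> sqdist x y <= D) ->
  (worst_risk Theta s Pi <= D%:E)%E.
Proof.
move=> D_ge; apply: ge_ereal_sup => _ [theta Theta_theta <-].
apply: (@le_trans _ _ (\int[gaussian s theta]_y (cst D%:E y))%E).
  apply: (ge0_le_integral_EFin _ (g := fun=> D)) => //.
  - by move=> y; apply: sumr_ge0 => i _; exact: sqr_ge0.
  - apply: measurable_sum => i; apply: measurable_funX.
    apply: measurable_funB => //.
    exact: measurableT_comp (measurable_tnth i) mle.1.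
  - by move=> y; apply: D_ge => //; exact: (mle.2 y).1.
by rewrite integral_cst//= probability_setT mule1.
Qed.

Lemma competitive_ratio_bounds (L U C : R) : 0 < L ->
  (L%:E <= minimax_risk Theta s)%E -> (worst_risk Theta s Pi <= U%:E)%E ->
  U <= C * L -> (1%:E <= competitive_ratio Theta s Pi <= C%:E)%E.
Proof.
move=> L0 L_le U_ge UCL.
(* The projection is itself a measurable estimator, hence the lower bound 1 for the ratio. *)
have M_le : (minimax_risk Theta s <= worst_risk Theta s Pi)%E.
  by apply: ereal_inf_lbound; exists Pi => //; exact: mle.1.
rewrite /competitive_ratio.
case: (minimax_risk Theta s) L_le M_le => [M||] L_le M_le; last 2 first.
- by have := le_trans M_le U_ge.
- by move: L_le; rewrite leeNy_eq.
case: (worst_risk Theta s Pi) M_le U_ge => [W||] M_le U_ge //.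
move: L_le M_le U_ge; rewrite !lee_fin => L_le M_le U_ge.
have M0 : 0 < M by exact: lt_le_trans L_le.
have C0 : 0 <= C.
  rewrite -(pmulr_lge0 _ L0) (le_trans _ UCL)// (le_trans _ U_ge)//.
  by rewrite (le_trans _ M_le)// ltW.
rewrite inver gt_eqF// -EFinM !lee_fin.
rewrite ler_pdivlMr// mul1r M_le/= ler_pdivrMr//.
by rewrite (le_trans U_ge)// (le_trans UCL)// ler_wpM2l.
Qed.

End mle_risk.

(** * Numerical bounds on exponentials and logarithms *)

Section logarithms.
Context {R : realType}.

Lemma ln2_ge_half : 1 / 2 <= ln 2 :> R.
Proof.
have : ln (1 + - (1 / 2)) <= - (1 / 2) :> R by apply: le_ln1Dx; lra.
have -> : 1 + - (1 / 2) = 2^-1 :> R by field.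
by rewrite lnV ?posrE// lerN2.
Qed.

Lemma expR1_le4 : expR 1 <= 4 :> R.
Proof.
have := expR_ge1Dx (- (1 / 2) : R).
have e0 := expR_gt0 (1 / 2 : R).
have -> : expR 1 = expR (1 / 2) ^+ 2 :> R by rewrite expr2 -expRD; congr expR; lra.
rewrite expRN => h.
have : expR (1 / 2) <= 2 :> R.
  have := ler_wpM2r (ltW e0) h; rewrite mulVf ?gt_eqF//; lra.
move=> e2; have -> : (4 : R) = 2 ^+ 2 by lra.
by rewrite lerXn2r// ?nnegrE ltW.
Qed.

(** The undetectability condition for spikes of height [u / 2]. With [M = n %/ k + 1], both
    [n / k <= M] and [2 <= M], so [1 + ln (n / k) <= 2 ln M + ln M]. *)
Lemma expR_quarter_log_le (n k : nat) : (0 < k <= n)%N ->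
  expR ((1 + ln (n%:R / k%:R)) / 4) <= (n %/ k).+1%:R :> R.
Proof.
move=> /andP[k0 kn].
have kR : 0 < k%:R :> R by rewrite ltr0n.
have nR : 0 < n%:R :> R by rewrite ltr0n (leq_trans k0).
have M0 : 0 < (n %/ k).+1%:R :> R by rewrite ltr0n.
have lnM_x : ln (n%:R / k%:R) <= ln (n %/ k).+1%:R :> R.
  rewrite ler_ln ?posrE ?divr_gt0// ler_pdivrMr// -natrM ler_nat.
  by rewrite ltnW// ltn_ceil.
have lnM_2 : ln 2 <= ln (n %/ k).+1%:R :> R.
  by rewrite ler_ln ?posrE// ler_nat ltnS divn_gt0.
rewrite -[leRHS]lnK ?posrE// ler_expR.
have := ln2_ge_half; move: lnM_x lnM_2; lra.
Qed.

End logarithms.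

(** * From risk bounds to competitive ratios *)

Section regimes.
Context {R : realType}.
Variables (n : nat) (s : R).
Hypotheses (s0 : 0 < s).
Variables (Theta : set (n.-tuple R)) (Pi : n.-tuple R -> n.-tuple R).
Hypothesis mle : is_mle Theta Pi.

Definition contains_sparse (k : nat) (tau : R) := forall theta : n.-tuple R,
  (l0_norm theta <= k)%N ->
  (forall i, tnth theta i = 0 \/ tnth theta i = tau) -> Theta theta.

Lemma competitive_ratio_sparse (k : nat) (tau B C : R) : (0 < k <= n)%N ->
  0 < tau -> expR (tau ^+ 2 / s ^+ 2) <= (n %/ k).+1%:R ->
  contains_sparse k tau ->
  (worst_risk Theta s Pi <= (B * (k%:R * tau ^+ 2))%:E)%E -> 16 * B <= C ->
  (1%:E <= competitive_ratio Theta s Pi <= C%:E)%E.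
Proof.
move=> kn tau0 tau_le Theta_sparse risk_le BC.
have kR : 0 < k%:R :> R by rewrite ltr0n; case/andP: kn.
have kt0 : 0 < k%:R * tau ^+ 2 by rewrite mulr_gt0// exprn_gt0.
apply: (competitive_ratio_bounds mle (L := k%:R * tau ^+ 2 / 16) _ _ risk_le).
- by rewrite divr_gt0.
- apply: minimax_risk_sparse_ge tau_le Theta_sparse => //.
  + by rewrite gt_eqF.
  + exact: ltW.
- by have := ler_wpM2r (ltW kt0) BC; lra.
Qed.

(** Truncation at level 0 leaves only the noise term. *)
Lemma worst_risk_mle_le_dim : (worst_risk Theta s Pi <= (64 * n%:R * s ^+ 2)%:E)%E.
Proof.
have A0 x y : Theta x -> Theta y ->
    \sum_(i < n) Num.min `|tnth x i - tnth y i| 0 <= 0.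
  by move=> _ _; rewrite big1// => i _; apply/min_idPr.
apply: le_trans (worst_risk_mle_le s0 mle (lexx 0) A0) _.
rewrite lee_fin expr0n/= oppr0 mul0r expR0 !mulr0 add0r mulr1.
have sqrt2 : Num.sqrt 2 <= 2 :> R.
  by rewrite -[leRHS](@ger0_norm R)// -sqrtr_sqr ler_sqrt; lra.
have : n%:R * s ^+ 2 * Num.sqrt 2 <= n%:R * s ^+ 2 * 2.
  by rewrite ler_wpM2l// mulr_ge0// sqr_ge0.
lra.
Qed.

(** The case [k = n]: blocks of length one, where a spike of height [r / 2] is undetectable because
    [r <= s]. Here [64 r^2 = 256 (r / 2)^2] and [16 * 256 = 4096]. *)
Lemma competitive_ratio_cube (r C : R) : (0 < n)%N -> 0 < r <= s ->
  (forall theta : n.-tuple R,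
    (forall i, tnth theta i = 0 \/ tnth theta i = r / 2) -> Theta theta) ->
  (worst_risk Theta s Pi <= (64 * n%:R * r ^+ 2)%:E)%E -> 4096 <= C ->
  (1%:E <= competitive_ratio Theta s Pi <= C%:E)%E.
Proof.
move=> n0 /andP[r0 rs] cube risk_le C_ge.
apply: (@competitive_ratio_sparse n (r / 2) 256) => //.
- by rewrite n0/=.
- by rewrite divr_gt0.
- apply: le_trans (expR_quarter_log_le (R := R) (n := n) (k := n) _); last first.
    by rewrite n0/=.
  rewrite ler_expR divff ?ln1 ?addr0 ?pnatr_eq0 -?lt0n//.
  rewrite ler_pdivrMr ?exprn_gt0// expr_div_n mulrC mulrA.
  have : r ^+ 2 <= s ^+ 2 by rewrite lerXn2r// ?nnegrE ltW.
  lra.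
- by move=> theta _; exact: cube.
- apply: le_trans risk_le _; rewrite lee_fin le_eqVlt; apply/orP; left.
  by apply/eqP; field.
- by lra.
Qed.

(* The level [3 u] is large enough for [n exp(- (3u)^2 / (8 s^2)) <= k]. *)
Lemma competitive_ratio_log (k : nat) (u C : R) : (0 < k <= n)%N ->
  0 <= u -> u ^+ 2 = s ^+ 2 * (1 + ln (n%:R / k%:R)) ->
  contains_sparse k (u / 2) ->
  (forall x y, Theta x -> Theta y ->
    \sum_(i < n) Num.min `|tnth x i - tnth y i| (3 * u) <= 20 * k%:R * u) ->
  20480 <= C ->
  (1%:E <= competitive_ratio Theta s Pi <= C%:E)%E.
Proof.
move=> kn u0 u2 Theta_sparse A_le C_ge; have /andP[k0 kn'] := kn.
have s20 : 0 < s ^+ 2 by rewrite exprn_gt0.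
have kR : 0 < k%:R :> R by rewrite ltr0n.
have nR : 0 < n%:R :> R by rewrite ltr0n (leq_trans k0).
have ln0 : 0 <= ln (n%:R / k%:R) :> R.
  by apply: ln_ge0; rewrite ler_pdivlMr// mul1r ler_nat.
have s2u2 : s ^+ 2 <= u ^+ 2 by rewrite u2 ler_pMr// lerDl.
have ugt0 : 0 < u by rewrite lt0r u0 andbT -sqrf_eq0 gt_eqF// (lt_le_trans s20).
(* The signal term is [240 k u^2] and the noise term at most [64 k u^2]; together they stay below
   [320 k u^2 = 1280 k (u / 2)^2]. *)
apply: (@competitive_ratio_sparse k (u / 2) 1280) => //.
- by rewrite divr_gt0.
- apply: le_trans (expR_quarter_log_le kn); rewrite ler_expR.
  rewrite expr_div_n u2 le_eqVlt; apply/orP; left; apply/eqP.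
  by field; rewrite gt_eqF.
- have tau0 : 0 <= 3 * u by rewrite mulr_ge0.
  apply: le_trans (worst_risk_mle_le s0 mle tau0 A_le) _; rewrite lee_fin.
  have sqrt2 : Num.sqrt 2 <= 2 :> R.
    by rewrite -[leRHS](@ger0_norm R)// -sqrtr_sqr ler_sqrt; lra.
  have exp_le : n%:R * expR (- (3 * u) ^+ 2 / (8 * s ^+ 2)) <= k%:R.
    rewrite -ler_pdivlMl// [leRHS]mulrC.
    have -> : k%:R / n%:R = expR (- ln (n%:R / k%:R)) :> R.
      by rewrite expRN lnK ?posrE ?divr_gt0// invf_div.
    rewrite ler_expR mulNr lerN2 ler_pdivlMr ?mulr_gt0// exprMn u2.
    have := mulr_ge0 (ltW s20) ln0; move: s20; lra.
  have {exp_le}h1 :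
      n%:R * Num.sqrt 2 * expR (- (3 * u) ^+ 2 / (8 * s ^+ 2)) <= 2 * k%:R.
    by rewrite mulrAC mulrC; apply: ler_pM.
  have h2 := ler_wpM2l (ltW s20) h1.
  have h3 : s ^+ 2 * k%:R <= u ^+ 2 * k%:R by rewrite ler_pM2r.
  have h4 : 0 <= u ^+ 2 * k%:R by rewrite mulr_ge0// sqr_ge0.
  rewrite expr_div_n; move: h2 h3 h4.
  set E := expR _ => h2 h3 h4.
  have -> : 4 * (3 * u) * (20 * k%:R * u) = 240 * (u ^+ 2 * k%:R) by ring.
  have -> : 1280 * (k%:R * (u ^+ 2 / 2 ^+ 2)) = 320 * (u ^+ 2 * k%:R) by field.
  have -> : 32 * s ^+ 2 * (n%:R * Num.sqrt 2) * E =
    32 * (s ^+ 2 * (n%:R * Num.sqrt 2 * E)) by ring.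
  lra.
- by lra.
Qed.

End regimes.

(** * Balls *)

Section lp_balls.
Context {R : realType} (n : nat).
Implicit Types (p tau u : R) (x y theta : n.-tuple R).

Lemma powR_one p : 1 `^ p = 1. Proof. by rewrite powR1. Qed.

Lemma lp_ballP p x : 0 < p ->
  lp_ball n p%:E x <-> \sum_(i < n) `|tnth x i| `^ p <= 1.
Proof.
move=> p0; rewrite /lp_ball/= /lp_norm; set S := \sum_(i < n) _.
have S0 : 0 <= S by apply: sumr_ge0 => i _; exact: powR_ge0.
split => [S_le|S_le].
  have <- : (S `^ p^-1) `^ p = S by rewrite -powRrM mulVf ?powRr1// lt0r_neq0.
  rewrite -[leRHS](powR_one p).
  by apply: ge0_ler_powR; rewrite ?nnegrE ?powR_ge0 ?(ltW p0).
suff : S `^ p^-1 <= 1 `^ p^-1 by rewrite powR_one.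
by apply: ge0_ler_powR; rewrite ?nnegrE ?invr_ge0// ltW.
Qed.

Lemma lp_ball_coord_le1 p x i : 0 < p -> lp_ball n p%:E x -> `|tnth x i| <= 1.
Proof.
move=> p0 /(lp_ballP _ p0) x_le; rewrite leNgt; apply/negP => x_gt.
have : 1 < `|tnth x i| `^ p.
  by rewrite -[ltLHS](powR_one p); apply: gt0_ltr_powR; rewrite // nnegrE.
apply/negP; rewrite -leNgt; apply: le_trans x_le.
by rewrite (bigD1 i)//= lerDl sumr_ge0// => j _; exact: powR_ge0.
Qed.

Lemma sparse_lp_ball p tau (k : nat) : 0 < p -> 0 <= tau ->
  k%:R * tau `^ p <= 1 -> contains_sparse (lp_ball n p%:E) k tau.
Proof.
move=> p0 tau0 ktau theta theta_k thetaE; apply/lp_ballP => //.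
apply: le_trans ktau.
rewrite (bigID (fun i => tnth theta i != 0))/= [X in _ + X]big1 ?addr0; last first.
  by move=> i /negPn/eqP ->; rewrite normr0 powR0// gt_eqF.
rewrite (eq_bigr (fun=> tau `^ p)) => [|i i0]; last first.
  by case: (thetaE i) i0 => [->|->]; rewrite ?eqxx// ger0_norm.
rewrite sumr_const -[leLHS]mulr_natl ler_wpM2r ?powR_ge0// ler_nat.
exact: theta_k.
Qed.

(** Entries are at most 1 in absolute value, so squares are below [p]-th powers. *)
Lemma sum_sqr_lp_ball p x : 0 < p <= 2 -> lp_ball n p%:E x ->
  \sum_(i < n) (tnth x i) ^+ 2 <= 1.
Proof.
move=> /andP[p0 p2] xB; apply: le_trans ((lp_ballP x p0).1 xB).
apply: ler_sum => i _; rewrite -real_normK ?num_real//.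
have [->|xi0] := eqVneq (tnth x i) 0; first by rewrite normr0 expr0n powR_ge0.
rewrite -powR_mulrn//; apply: ger_powR => //.
by rewrite normr_gt0 xi0 (lp_ball_coord_le1 i p0 xB).
Qed.

Lemma sqdist_le x y (D : R) :
  \sum_(i < n) (tnth x i) ^+ 2 <= D -> \sum_(i < n) (tnth y i) ^+ 2 <= D ->
  sqdist x y <= 4 * D.
Proof.
move=> xD yD; apply: (@le_trans _ _ (2 * (\sum_(i < n) (tnth x i) ^+ 2) +
    2 * \sum_(i < n) (tnth y i) ^+ 2)); last lra.
rewrite !mulr_sumr -big_split/=; apply: ler_sum => i _.
have := sqr_ge0 (tnth x i + tnth y i); rewrite sqrrD sqrrB; lra.
Qed.

Lemma min_norm_subr_le (a b u : R) : 0 <= u ->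
  Num.min `|a - b| u <= Num.min `|a| u + Num.min `|b| u.
Proof.
move=> u0; have ab := ler_normB a b.
have a0 := normr_ge0 a; have b0 := normr_ge0 b.
by rewrite !minElt; case: ltP => ?; case: ltP => ?; case: ltP => ?; lra.
Qed.

(* Termwise, [min |a| u <= |a|^p u^(1-p)]. *)
Lemma sum_min_lp_ball_le1 p u x : 0 < p <= 1 -> 0 < u -> lp_ball n p%:E x ->
  \sum_(i < n) Num.min `|tnth x i| u <= u * u `^ (- p).
Proof.
move=> /andP[p0 p1] u0 xB.
apply: (@le_trans _ _ ((\sum_(i < n) `|tnth x i| `^ p) * (u * u `^ (- p)))).
  (* Rewritten as [u (a / u)^p], the bound exceeds [u] when [a > u], and [a] otherwise since
     [p <= 1]. *)
  rewrite mulr_suml; apply: ler_sum => i _; set a := `|tnth x i|.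
  have a0 : 0 <= a by exact: normr_ge0.
  have -> : a `^ p * (u * u `^ (- p)) = u * (a / u) `^ p.
    rewrite powRM ?invr_ge0 ?(ltW u0)// -[u^-1]powR_inv1 ?(ltW u0)//.
    by rewrite -powRrM mulN1r; ring.
  have [au|ua] := leP a u; last first.
    rewrite ler_peMr ?(ltW u0)// -[leLHS](powR_one p).
    apply: ge0_ler_powR; rewrite ?nnegrE ?divr_ge0 ?(ltW p0) ?(ltW u0)//.
    by rewrite ler_pdivlMr// mul1r ltW.
  have [a_eq0|a_neq0] := eqVneq a 0.
    by rewrite a_eq0 mulr_ge0 ?powR_ge0// ltW.
  rewrite -{1}(divfK (lt0r_neq0 u0) a) mulrC ler_pM2l//.
  apply: ger1_powR => //; apply/andP; split.
    by rewrite divr_gt0// lt0r a_neq0.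
  by rewrite ler_pdivrMr// mul1r.
rewrite ler_piMl ?mulr_ge0 ?powR_ge0 ?(ltW u0)//.
exact: (lp_ballP x p0).1.
Qed.

(* Termwise, [|a| <= 1/n + n^(p-1) |a|^p], and [n^(p-1) <= e] in this range. *)
Lemma sum_norm_lp_ball p x : (0 < n)%N -> 1 < p ->
  p <= 1 + 1 / (1 + ln n%:R) -> lp_ball n p%:E x ->
  \sum_(i < n) `|tnth x i| <= 5.
Proof.
move=> n0 p1 p_le xB; have p0 : 0 < p by exact: lt_trans p1.
have nR : 0 < n%:R :> R by rewrite ltr0n.
have ln0 : 0 <= ln n%:R :> R by apply: ln_ge0; rewrite ler1n.
have n_pow : n%:R `^ (p - 1) <= 4.
  rewrite /powR gt_eqF//; apply: le_trans expR1_le4; rewrite ler_expR.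
  apply: (@le_trans _ _ (1 / (1 + ln n%:R) * ln n%:R)).
    by rewrite ler_wpM2r//; lra.
  by rewrite mulrAC mul1r ler_pdivrMr ?mul1r; lra.
apply: (@le_trans _ _
    (\sum_(i < n) (n%:R^-1 + n%:R `^ (p - 1) * `|tnth x i| `^ p))).
  apply: ler_sum => i _; set a := `|tnth x i|.
  (* Either the term [1 / n] suffices, or [(n a)^(p - 1) >= 1]. *)
  have [a_le|a_gt] := leP a n%:R^-1.
    by rewrite ler_wpDr// mulr_ge0// powR_ge0.
  have a0 : 0 < a by apply: lt_trans a_gt; rewrite invr_gt0.
  rewrite ler_wpDl ?invr_ge0// -(mulr_powRB1 (ltW a0) p0) mulrCA.
  rewrite ler_peMr ?(ltW a0)// -powRM ?(ltW a0)// -[leLHS](powR_one (p - 1)).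
  apply: ge0_ler_powR; rewrite ?nnegrE ?mulr_ge0 ?(ltW a0)//; first by lra.
  by rewrite -ler_pdivrMl// mulr1 ltW.
rewrite big_split/= sumr_const card_ord -[_ *+ n]mulr_natl mulfV ?gt_eqF//.
rewrite -mulr_sumr.
have := (lp_ballP x p0).1 xB; have := powR_ge0 n%:R (p - 1) => h0 h1.
have := ler_pM h0 (sumr_ge0 _ (fun i _ => powR_ge0 `|tnth x i| p)) n_pow h1.
lra.
Qed.

End lp_balls.

(** * Noise regimes for the balls *)

Section lp_ball_regimes.
Context {R : realType}.
Variables (n : nat) (s : R).
Hypotheses (n0 : (0 < n)%N) (s0 : 0 < s).
Variables (Pi : n.-tuple R -> n.-tuple R) (C : R).
Hypothesis C_ge : 20480 <= C.
Implicit Types (p u : R).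

Let nR : 0 < n%:R :> R. Proof. by rewrite ltr0n. Qed.

(** The cube of side [s / 2] fits in the ball, so both risks are of order [n s^2]. *)
Lemma competitive_ratio_lp_small_noise p : 0 < p ->
  is_mle (lp_ball n p%:E) Pi -> n%:R * s `^ p <= 1 ->
  (1%:E <= competitive_ratio (lp_ball n p%:E) s Pi <= C%:E)%E.
Proof.
move=> p0 mle ns; have risk_le := worst_risk_mle_le_dim s0 mle.
have C4096 : 4096 <= C by move: C_ge; lra.
have ss : 0 < s <= s by rewrite s0 lexx.
apply: (competitive_ratio_cube s0 mle n0 ss _ risk_le C4096).
- move=> theta; apply: (sparse_lp_ball (k := n) p0).
  + by rewrite divr_ge0// ltW.
  + apply: le_trans ns; rewrite ler_pM2l//.
    rewrite ge0_ler_powR ?nnegrE ?(ltW p0) ?(ltW s0)//.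
      by rewrite divr_ge0// ltW.
    by move: s0; lra.
  + by rewrite /l0_norm -[leqRHS]card_ord max_card.
Qed.

(** One spike of height 1/2 is undetectable at this noise level, and the squared diameter is at most
    [4 = 16 (1/2)^2]. *)
Lemma competitive_ratio_lp_large_noise p : 0 < p <= 2 ->
  is_mle (lp_ball n p%:E) Pi -> 1 <= s ^+ 2 * (1 + ln n%:R) ->
  (1%:E <= competitive_ratio (lp_ball n p%:E) s Pi <= C%:E)%E.
Proof.
move=> p02 mle s_ge; have /andP[p0 p2] := p02.
apply: (competitive_ratio_sparse s0 mle (k := 1) (tau := 1 / 2) (B := 16)).
- by rewrite n0.
- by [].
- have n1 : (0 < 1 <= n)%N by rewrite n0.
  apply: le_trans (expR_quarter_log_le n1); rewrite ler_expR divr1.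
  rewrite ler_pdivrMr ?exprn_gt0// mulrAC [X in _ <= X / 4]mulrC expr_div_n.
  by move: s_ge; lra.
- apply: sparse_lp_ball => //; rewrite [leLHS]mul1r.
  by rewrite -[leRHS](powR_one p) ge0_ler_powR ?nnegrE ?(ltW p0)//; lra.
- apply: le_trans (worst_risk_mle_le_diam s mle (D := 4 * 1) _) _.
    by move=> x y xB yB; apply: sqdist_le; apply: sum_sqr_lp_ball p02 _.
  by rewrite lee_fin expr_div_n; lra.
- by move: C_ge; lra.
Qed.

Lemma discrete_crossing (f : nat -> R) (N : nat) : (0 < N)%N ->
  f 1 <= 1 -> 1 < f N -> exists k, [/\ (0 < k < N)%N, f k <= 1 & 1 < f k.+1].
Proof.
elim: N => // N IH _ f1 fN; case: (posnP N) => [N0|N0].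
  by move: fN; rewrite N0 ltNge f1.
have [fN_le|fN_gt] := leP (f N) 1; first by exists N; rewrite N0 ltnSn.
have [k [/andP[k0 kN] fk fk1]] := IH N0 f1 fN_gt.
by exists k; rewrite k0 ltnS ltnW.
Qed.

(** The product [k u_k^p] is at most 1 at [k = 1] by the bound on [s], and exceeds 1 at [k = n],
    where [u_n = s]. Just before a crossing, [k u^p <= 1] puts the sparse vectors in the ball, while
    the crossing itself bounds truncated norms by a multiple of [k u]. *)
Lemma competitive_ratio_lp_middle_noise p : 0 < p <= 1 + 1 / (1 + ln n%:R) ->
  is_mle (lp_ball n p%:E) Pi -> s ^+ 2 * (1 + ln n%:R) <= 1 ->
  1 < n%:R * s `^ p ->
  (1%:E <= competitive_ratio (lp_ball n p%:E) s Pi <= C%:E)%E.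
Proof.
have half_le (x : R) : 0 <= x -> x / 2 <= x by lra.
have triple_ge (x : R) : 0 <= x -> x <= 3 * x by lra.
move=> /andP[p0 p_le] mle s_le ns.
pose u_ (k : nat) := s * Num.sqrt (1 + ln (n%:R / k%:R)).
have ln_div_ge0 k : (0 < k <= n)%N -> 0 <= ln (n%:R / k%:R) :> R.
  move=> /andP[k0 kn]; apply: ln_ge0.
  by rewrite ler_pdivlMr ?ltr0n// mul1r ler_nat.
have u2 k : (0 < k <= n)%N -> u_ k ^+ 2 = s ^+ 2 * (1 + ln (n%:R / k%:R)).
  by move=> /ln_div_ge0 ?; rewrite exprMn sqr_sqrtr// addr_ge0.
have u_ge0 k : 0 <= u_ k by rewrite mulr_ge0 ?sqrtr_ge0// ltW.
have u1_le1 : u_ 1%N <= 1.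
  by rewrite -(@ler_pXn2r _ 2)// ?nnegrE// expr1n u2 ?n0// divr1.
have f1 : 1%:R * u_ 1%N `^ p <= 1.
  rewrite mul1r -[leRHS](powR_one p) ge0_ler_powR ?nnegrE ?(ltW p0)//.
have fn : 1 < n%:R * u_ n `^ p.
  by rewrite /u_ divff ?gt_eqF// ln1 addr0 sqrtr1 mulr1.
have [k [/andP[k0 kn] fk fk1]] :=
  discrete_crossing (f := fun k => k%:R * u_ k `^ p) n0 f1 fn.
have kn' : (0 < k <= n)%N by rewrite k0 ltnW.
have kR : 1 <= k%:R :> R by rewrite ler1n.
set u := u_ k in fk.
have u0 : 0 < u.
  rewrite lt0r u_ge0 andbT -sqrf_eq0 u2// gt_eqF// mulr_gt0 ?exprn_gt0//.
  by rewrite ltr_wpDr// ln_div_ge0.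
have up0 : 0 < u `^ p by exact: powR_gt0.
have up_le1 : u `^ p <= 1 by apply: le_trans fk; rewrite ler_peMl// ltW.
have u_le1 : u <= 1.
  rewrite leNgt; apply/negP => u1; move: up_le1; apply/negP; rewrite -ltNge.
  by rewrite -[ltLHS](powR_one p) gt0_ltr_powR ?nnegrE// ltW.
(* Going back from [k + 1] to [k] costs a factor 2: [k + 1 <= 2 k], and [u_] decreases. *)
have ku : 1 < 2 * k%:R * u `^ p.
  have k1 : k.+1%:R <= 2 * k%:R :> R.
    by rewrite -natrM ler_nat mul2n -addnn -addn1 leq_add2l.
  have u1 : u_ k.+1 <= u.
    rewrite /u /u_ ler_pM2l// ler_sqrt; last by rewrite addr_ge0// ln_div_ge0.
    rewrite lerD2l ler_ln ?posrE ?divr_gt0 ?ltr0n// ler_pM2l//.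
    by rewrite lef_pV2 ?posrE ?ltr0n// ler_nat.
  have u1p : u_ k.+1 `^ p <= u `^ p.
    by rewrite ge0_ler_powR ?nnegrE ?(ltW p0) ?(ltW u0).
  exact: lt_le_trans fk1 (ler_pM (ler0n _ _) (powR_ge0 _ _) k1 u1p).
apply: (competitive_ratio_log s0 mle kn' (ltW u0) (u2 k kn')) => //.
  apply: sparse_lp_ball => //; first by rewrite divr_ge0// ltW.
  apply: le_trans fk; rewrite ler_pM2l ?(lt_le_trans ltr01)//.
  by rewrite ge0_ler_powR ?nnegrE ?divr_ge0 ?(ltW p0) ?(ltW u0) ?half_le ?ltW.
move=> x y xB yB.
have k20 : 0 < 2 * k%:R :> R by rewrite mulr_gt0// ltr0n.
have uk0 : 0 <= k%:R * u by rewrite mulr_ge0// ltW.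
have tau0 : 0 < 3 * u by rewrite mulr_gt0.
apply: (@le_trans _ _ (\sum_(i < n) Num.min `|tnth x i| (3 * u) +
                       \sum_(i < n) Num.min `|tnth y i| (3 * u))).
  rewrite -big_split; apply: ler_sum => i _.
  by apply: min_norm_subr_le; exact: ltW.
have [p1|p1] := leP p 1.
  have p01 : 0 < p <= 1 by rewrite p0.
  have := sum_min_lp_ball_le1 p01 tau0 xB.
  have := sum_min_lp_ball_le1 p01 tau0 yB.
  (* Each of the two truncated sums is then at most [6 k u]. *)
  have tau_p : (3 * u) `^ (- p) <= 2 * k%:R.
    have tp0 : 0 < (3 * u) `^ p by exact: powR_gt0.
    rewrite powRN -(ler_pM2r tp0) mulVf ?gt_eqF//.
    apply: le_trans (ltW ku) _; rewrite ler_pM2l//.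
    by rewrite ge0_ler_powR ?nnegrE ?(ltW p0) ?(ltW u0) ?(ltW tau0)
      ?triple_ge ?ltW.
  have := ler_wpM2l (ltW tau0) tau_p; move: uk0; clear; lra.
(* As [u <= 1 < p], [u^p <= u]. Each l_1 norm is then at most [5 <= 10 k u]; the two together
   explain the constant 20. *)
have uk : 1 <= 2 * (k%:R * u).
  rewrite mulrA; apply: le_trans (ltW ku) _; rewrite ler_pM2l//.
  by apply: ge1r_powR; rewrite ?u0 ?u_le1// ltW.
have min_le (z : n.-tuple R) : \sum_(i < n) Num.min `|tnth z i| (3 * u) <=
    \sum_(i < n) `|tnth z i|.
  by apply: ler_sum => i _; rewrite ge_min lexx.
have := sum_norm_lp_ball n0 p1 p_le xB; have := sum_norm_lp_ball n0 p1 p_le yB.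
have := min_le x; have := min_le y; move: uk; clear; lra.
Qed.

(* [rho] is [n^(-1/p)], and [1] for [p = +oo]. *)
Lemma lp_ball_ge2 (p : \bar R) : (2%:E <= p)%E -> exists rho : R, [/\ 0 < rho,
  forall x, lp_ball n p x ->
    \sum_(i < n) (tnth x i) ^+ 2 <= 2 * n%:R * rho ^+ 2 &
  forall (r : R) theta, 0 <= r <= rho ->
    (forall i, tnth theta i = 0 \/ tnth theta i = r) -> lp_ball n p theta].
Proof.
case: p => [p| |//] p2; last first.
  exists 1; split=> // [x xB|r theta /andP[r0 r1] thetaE].
    rewrite expr1n mulr1 (@le_trans _ _ n%:R)//; last by move: nR; lra.
    rewrite -[n in n%:R]card_ord -sumr_const; apply: ler_sum => i _.
    rewrite -real_normK ?num_real// expr_le1// (le_trans _ xB)//.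
    exact: le_bigmax.
  rewrite /lp_ball/= /lp_norm; apply: bigmax_le => // i _.
  by case: (thetaE i) => ->; rewrite ?normr0// ger0_norm.
move: p2; rewrite lee_fin => p2; have p0 : 0 < p by apply: lt_le_trans p2.
pose rho := n%:R `^ (- p^-1).
have rho0 : 0 < rho by exact: powR_gt0.
have rho_p : rho `^ p = n%:R^-1.
  by rewrite -powRrM mulNr mulVf ?gt_eqF// powR_inv1 ?ltW.
exists rho; split => // [x xB|r theta /andP[r0 r_le] thetaE]; last first.
  apply: (sparse_lp_ball (k := n) p0 r0) thetaE.
    have : r `^ p <= n%:R^-1.
      by rewrite -rho_p ge0_ler_powR ?nnegrE ?(ltW p0) ?(ltW rho0).
    by rewrite -(ler_pM2l nR) mulfV ?gt_eqF.
  by rewrite /l0_norm -[leqRHS]card_ord max_card.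
apply: (@le_trans _ _
    (\sum_(i < n) (rho ^+ 2 + rho ^+ 2 * n%:R * `|tnth x i| `^ p))).
  apply: ler_sum => i _; rewrite -real_normK ?num_real//; set a := `|tnth x i|.
  have a0 : 0 <= a by exact: normr_ge0.
  (* For [a > rho], [(a / rho)^2 <= (a / rho)^p = n a^p], since [p >= 2] and [rho^p = 1 / n]. *)
  have [a_le|a_gt] := leP a rho.
    rewrite ler_wpDr ?lerXn2r ?nnegrE ?(ltW rho0)//.
    by rewrite !mulr_ge0 ?powR_ge0 ?sqr_ge0.
  rewrite ler_wpDl ?sqr_ge0//.
  have -> : a ^+ 2 = rho ^+ 2 * (a / rho) ^+ 2.
    by field; rewrite gt_eqF.
  rewrite -mulrA ler_pM2l ?exprn_gt0//.
  have -> : n%:R * a `^ p = (a / rho) `^ p.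
    rewrite powRM ?invr_ge0 ?(ltW rho0)// mulrC; congr (_ * _).
    rewrite -[rho^-1]powR_inv1 ?(ltW rho0)// powRAC rho_p powR_inv1 ?invrK//.
  rewrite -powR_mulrn ?divr_ge0 ?(ltW rho0)//; apply: ler_powR => //.
  by rewrite ler_pdivlMr// mul1r ltW.
rewrite big_split/= sumr_const card_ord -mulr_sumr -mulr_natl.
have := ler_wpM2l (mulr_ge0 (sqr_ge0 rho) (ltW nR)) ((lp_ballP x p0).1 xB).
lra.
Qed.

(** A cube of side half the minimum of [s] and [rho] gives the lower bound; the dimension bound
    matches it when [s <= rho], the diameter bound otherwise. *)
Lemma competitive_ratio_lp_ge2 (p : \bar R) : (2%:E <= p)%E ->
  is_mle (lp_ball n p) Pi ->
  (1%:E <= competitive_ratio (lp_ball n p) s Pi <= C%:E)%E.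
Proof.
move=> /lp_ball_ge2[rho [rho0 ball_le cube]] mle.
have C4096 : 4096 <= C by move: C_ge; lra.
have [s_le|s_gt] := leP s rho.
  have ss : 0 < s <= s by rewrite s0 lexx.
  have risk_le := worst_risk_mle_le_dim s0 mle.
  apply: (competitive_ratio_cube s0 mle n0 ss _ risk_le C4096) => theta.
  by apply: cube; move: s0 s_le; lra.
have rs : 0 < rho <= s by rewrite rho0 ltW.
apply: (competitive_ratio_cube s0 mle n0 rs _ _ C4096).
- by move=> theta; apply: cube; move: rho0; lra.
- apply: le_trans (worst_risk_mle_le_diam s mle
    (D := 4 * (2 * n%:R * rho ^+ 2)) _) _.
    by move=> x y xB yB; apply: sqdist_le; exact: ball_le.
  rewrite lee_fin; have := mulr_ge0 (ltW nR) (sqr_ge0 rho); lra.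
Qed.

(** Each vector has at most [k] nonzero entries, so its truncated sum is at most [3 k u]. *)
Lemma competitive_ratio_l0 (k : nat) : (0 < k <= n)%N ->
  is_mle (l0_ball n k) Pi ->
  (1%:E <= competitive_ratio (l0_ball n k) s Pi <= C%:E)%E.
Proof.
move=> kn mle; have /andP[k0 kn'] := kn.
pose u := s * Num.sqrt (1 + ln (n%:R / k%:R)).
have ln0 : 0 <= ln (n%:R / k%:R) :> R.
  by apply: ln_ge0; rewrite ler_pdivlMr ?ltr0n// mul1r ler_nat.
have u0 : 0 <= u by rewrite mulr_ge0 ?sqrtr_ge0// ltW.
have u2 : u ^+ 2 = s ^+ 2 * (1 + ln (n%:R / k%:R)).
  by rewrite exprMn sqr_sqrtr// addr_ge0.
apply: (competitive_ratio_log s0 mle kn u0 u2) => // x y xB yB.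
have tau0 : 0 <= 3 * u by rewrite mulr_ge0.
have sum_le (z : n.-tuple R) : l0_ball n k z ->
    \sum_(i < n) Num.min `|tnth z i| (3 * u) <= k%:R * (3 * u).
  move=> zB; rewrite (bigID (fun i => tnth z i != 0))/=.
  rewrite [X in _ + X]big1 ?addr0; last first.
    by move=> i /negPn/eqP ->; rewrite normr0; apply/min_idPl.
  apply: (@le_trans _ _ (\sum_(i < n | tnth z i != 0) (3 * u))).
    by apply: ler_sum => i _; rewrite ge_min lexx orbT.
  by rewrite sumr_const -[leLHS]mulr_natl ler_wpM2r// ler_nat.
apply: (@le_trans _ _ (\sum_(i < n) Num.min `|tnth x i| (3 * u) +
                       \sum_(i < n) Num.min `|tnth y i| (3 * u))).
  rewrite -big_split; apply: ler_sum => i _; exact: min_norm_subr_le.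
have := sum_le x xB; have := sum_le y yB.
have : 0 <= k%:R * u by rewrite mulr_ge0.
lra.
Qed.

End lp_ball_regimes.

Theorem theorem1 (R : realType) :
  exists c C : R, [/\ 0 < c, c <= C &
    forall (d : nat) (sigma : R), (1 <= d)%N -> 0 < sigma ->
    [/\
      forall p : \bar R, (2%:E <= p)%E ->
        forall Pi : d.-tuple R -> d.-tuple R, is_mle (lp_ball d p) Pi ->
        (c%:E <= competitive_ratio (lp_ball d p) sigma Pi <= C%:E)%E,
      forall p : R, 0 < p <= 1 + 1 / (1 + ln d%:R) ->
        forall Pi : d.-tuple R -> d.-tuple R, is_mle (lp_ball d p%:E) Pi ->
        (c%:E <= competitive_ratio (lp_ball d p%:E) sigma Pi <= C%:E)%E,
      forall p : R, 1 + 1 / (1 + ln d%:R) < p < 2 ->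
        sigma <= 1 / d%:R `^ (1 / p) \/ 1 / Num.sqrt (1 + ln d%:R) <= sigma ->
        forall Pi : d.-tuple R -> d.-tuple R, is_mle (lp_ball d p%:E) Pi ->
        (c%:E <= competitive_ratio (lp_ball d p%:E) sigma Pi <= C%:E)%E &
      forall s : nat, (1 <= s <= d)%N ->
        forall Pi : d.-tuple R -> d.-tuple R, is_mle (l0_ball d s) Pi ->
        (c%:E <= competitive_ratio (l0_ball d s) sigma Pi <= C%:E)%E]].
Proof.
(* [C] is the largest constant over the regimes, the one of [competitive_ratio_log]. *)
exists 1, 20480; split => //; first by lra.
move=> d sigma d0 sigma0.
have dR : 0 < d%:R :> R by rewrite ltr0n.
have ln0 : 0 <= ln d%:R :> R by apply: ln_ge0; rewrite ler1n.
split => [p p2 Pi mle|p p_le Pi mle|p /andP[p_gt p_lt2] noise Pi mle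
         |s sd Pi mle].
- exact: competitive_ratio_lp_ge2.
- have /andP[p0 p_le'] := p_le.
  have p2 : p <= 2.
    apply: le_trans p_le' _.
    have : 1 / (1 + ln d%:R) <= 1 :> R by rewrite ler_pdivrMr; lra.
    lra.
  (* Three cases: inscribed cube, sparsity crossing, single spike. *)
  have [small|ns] := leP (d%:R * sigma `^ p) 1.
    exact: competitive_ratio_lp_small_noise.
  have [le1|gt1] := leP (sigma ^+ 2 * (1 + ln d%:R)) 1.
    exact: competitive_ratio_lp_middle_noise.
  by apply: competitive_ratio_lp_large_noise; rewrite ?p0// ltW.
- have p0 : 0 < p.
    apply: le_lt_trans p_gt; rewrite addr_ge0// divr_ge0//; lra.
  (* The two ranges translate into [d sigma^p <= 1] and [1 <= sigma^2 (1 + ln d)]. *)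
  case: noise => [small|large].
    apply: competitive_ratio_lp_small_noise => //.
    rewrite -ler_pdivlMl// mulr1.
    have <- : (1 / d%:R `^ (1 / p)) `^ p = d%:R^-1 :> R.
      by rewrite !div1r -powRN -powRrM mulNr mulVf ?gt_eqF// powR_inv1 ?ltW.
    by rewrite ge0_ler_powR ?nnegrE ?(ltW p0) ?(ltW sigma0).
  apply: competitive_ratio_lp_large_noise => //; first by rewrite p0 ltW.
  have l0 : 0 < 1 + ln d%:R :> R by lra.
  rewrite -(sqr_sqrtr (ltW l0)) -exprMn exprn_ege1//.
  by rewrite -ler_pdivrMr// sqrtr_gt0.
- exact: competitive_ratio_l0.
Qed.
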